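(* Let $G$ be a real semisimple Lie group with finitely many connected components, finite center and no compact factor, with Lie algebra $\mathfrak{g}$ and real rank $r$. The Chabauty compactification $\overline{\mathrm{Cartan}(\mathfrak{g})}^{\mathcal{S}}$ is not Zariski-closed in $\mathcal{G}r_r(\mathfrak{g})$.
   Context: A Cartan subspace of $\mathfrak{g}$ is an abelian Lie subalgebra, diagonalizable over $\mathbb{R}$, maximal for these properties; its dimension is $r$. $\mathcal{G}r_r(\mathfrak{g})$ is the Grassmannian of $r$-dimensional real subspaces of $\mathfrak{g}$, viewed as a real algebraic variety. $\mathrm{Cartan}(\mathfrak{g})\subset\mathcal{G}r_r(\mathfrak{g})$ is the set of Cartan subspaces and $\overline{\mathrm{Cartan}(\mathfrak{g})}^{\mathcal{S}}$ is its closure for the analytic topology. Zariski-closed refers to the real Zariski topology. *)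

(* Defs.v *)
From HB Require Import structures.
From mathcomp Require Import all_boot all_order all_algebra.
From mathcomp Require Import all_classical all_reals all_analysis.
(* Importing [mpoly] would clash with the notations of MathComp-Analysis. *)
From mathcomp Require mpoly.

Set Implicit Arguments.
Unset Strict Implicit.
Unset Printing Implicit Defensive.

Import Order.TTheory GRing.Theory Num.Theory.
Import numFieldNormedType.Exports.

Local Open Scope classical_set_scope.
Local Open Scope ring_scope.

HB.mixin Record Group_isTopologicalGroup G & Group G & Topological G := {
  mulg_continuous : continuous (fun p : G * G => (p.1 * p.2)%g);
  invg_continuous : continuous (fun x : G => (x^-1)%g)
}.

#[short(type="topologicalGroupType")]
HB.structure Definition TopologicalGroup :=
  {G of Group_isTopologicalGroup G & Group G & Topological G}.

Section Smooth.
Context {R : realType} {V W : normedModType R}.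

(* For finite-dimensional [V], and [U] open, this is being of class C^k on [U]:
   continuity of x |-> 'd f x is then equivalent to that of each x |-> 'd f x v. *)
Fixpoint class_C (k : nat) (U : set V) (f : V -> W) : Prop :=
  if k is k'.+1 then
    (forall x, U x -> differentiable f x) /\
    (forall v, class_C k' U (fun x => 'd f x v))
  else forall x, U x -> {for x, continuous f}.

Definition smooth_on (U : set V) (f : V -> W) := forall k, class_C k U f.

End Smooth.

(* A homeomorphism between an open subset of [M] and an open subset of R^n; the
   values of the two maps outside of these subsets are irrelevant. *)
Record chart (R : realType) (n : nat) (M : topologicalType) := Chart {
  chart_dom : set M;
  chart_cod : set 'rV[R]_n;
  chart_fun :> M -> 'rV[R]_n;
  chart_inv : 'rV[R]_n -> M;
  chart_dom_open : open chart_dom;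
  chart_cod_open : open chart_cod;
  chart_fun_cod : forall x, chart_dom x -> chart_cod (chart_fun x);
  chart_inv_dom : forall u, chart_cod u -> chart_dom (chart_inv u);
  chart_funK : forall x, chart_dom x -> chart_inv (chart_fun x) = x;
  chart_invK : forall u, chart_cod u -> chart_fun (chart_inv u) = u;
  chart_fun_continuous : forall x, chart_dom x -> {for x, continuous chart_fun};
  chart_inv_continuous : forall u, chart_cod u -> {for u, continuous chart_inv}
}.

HB.mixin Record TopologicalGroup_isLieGroup (R : realType) (n : nat) G
    & TopologicalGroup G := {
  lie_hausdorff : hausdorff_space G;
  lie_second_countable : @second_countable G;
  atlas : set (chart R n G);
  atlas_cover : forall x : G, exists2 c, atlas c & chart_dom c x;
  atlas_compatible : forall c d, atlas c -> atlas d ->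
    smooth_on [set u | chart_cod c u /\ chart_dom d (chart_inv c u)]
      (fun u => d (chart_inv c u));
  mulg_smooth : forall a b c, atlas a -> atlas b -> atlas c ->
    smooth_on [set p : 'rV[R]_n * 'rV[R]_n |
        [/\ chart_cod a p.1, chart_cod b p.2 &
            chart_dom c (chart_inv a p.1 * chart_inv b p.2)%g]]
      (fun p => c (chart_inv a p.1 * chart_inv b p.2)%g);
  invg_smooth : forall a b, atlas a -> atlas b ->
    smooth_on [set u | chart_cod a u /\ chart_dom b (chart_inv a u)^-1%g]
      (fun u => b (chart_inv a u)^-1%g)
}.

#[short(type="lieGroupType")]
HB.structure Definition LieGroup (R : realType) (n : nat) :=
  {G of TopologicalGroup_isLieGroup R n G & TopologicalGroup G}.

Definition finitely_many_components (G : topologicalType) :=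
  finite_set (range (connected_component [set: G])).

Definition finite_center (G : groupType) :=
  finite_set [set z : G | forall x, (z * x = x * z)%g].

HB.mixin Record Vector_isLieAlgebra (K : fieldType) g & Vector K g := {
  lie : g -> g -> g;
  lie_linearl : forall y, linear (lie^~ y);
  lie_linearr : forall x, linear (lie x);
  lie_alt : forall x, lie x x = 0;
  lie_jacobi : forall x y z,
    lie x (lie y z) + lie y (lie z x) + lie z (lie x y) = 0
}.

#[short(type="lieAlgType")]
HB.structure Definition LieAlgebra (K : fieldType) :=
  {g of Vector_isLieAlgebra K g & Vector K g}.

(* The chart [c] identifies the tangent space at 1 with R^n. If the group law
   is x + y + B(x, y) + (terms of other types, or of order > 2) in a chart
   centered at 1, with B bilinear, the bracket of left-invariant vector fields
   is B(u, v) - B(v, u), and B is the mixed second derivative of the group law. *)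
Definition tangent_bracket (R : realType) (n : nat) (G : lieGroupType R n)
    (c : chart R n G) (u v : 'rV[R]_n) : 'rV[R]_n :=
  let e := c 1%g in
  let mul x y : 'rV[R]_n := c (chart_inv c x * chart_inv c y)%g in
  'D_u (fun x => 'D_v (mul x) e) e - 'D_v (fun x => 'D_u (mul x) e) e.

Definition is_lie_algebra_of (R : realType) (n : nat) (G : lieGroupType R n)
    (g : lieAlgType R) :=
  exists2 c : chart R n G, atlas c /\ chart_dom c 1%g &
  exists2 f : {linear g -> 'rV[R]_n}, bijective f &
    forall x y : g, f (lie x y) = tangent_bracket c (f x) (f y).

Section LieAlgebraTheory.
Context {K : fieldType} {g : lieAlgType K}.
Implicit Types U V I J : {vspace g}.

Definition lie_prod U V : {vspace g} :=
  <<[seq lie x y | x <- vbasis U, y <- vbasis V]>>%VS.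

Definition lie_abelian U := forall x y, x \in U -> y \in U -> lie x y = 0.

Definition lie_ideal_of I J := (J <= I)%VS /\
  forall x y, x \in I -> y \in J -> lie x y \in J.

Definition lie_ideal I := lie_ideal_of fullv I.

Definition lie_solvable U := exists k, iter k (fun W => lie_prod W W) U = 0%VS.

Definition lie_simple I := ~ lie_abelian I /\
  forall J, lie_ideal_of I J -> J = 0%VS \/ J = I.

(* The trace of (ad x) (ad y) acting on the subalgebra [I]. *)
Definition killing I (x y : g) : K :=
  \sum_(i < \dim I) coord (vbasis I) i (lie x (lie y (vbasis I)`_i)).

(* [U] is diagonalizable over the base field: the ad x, for x in [U], are
   diagonal in a common basis of g. *)
Definition ad_diagonalizable U :=
  exists2 b : seq g, basis_of fullv b &
    forall x v, x \in U -> v \in b -> exists a : K, lie x v = a *: v.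

Definition cartan_subspace U :=
  [/\ lie_abelian U, ad_diagonalizable U &
      forall V, lie_abelian V -> ad_diagonalizable V -> (U <= V)%VS -> V = U].

End LieAlgebraTheory.

Definition semisimple (K : fieldType) (g : lieAlgType K) :=
  forall I : {vspace g}, lie_ideal I -> lie_solvable I -> I = 0%VS.

(* A semisimple real Lie algebra is compact when its Killing form is negative
   definite. *)
Definition compact_lie (R : realType) (g : lieAlgType R) (I : {vspace g}) :=
  forall x, x \in I -> x != 0 -> killing I x x < 0.

Definition no_compact_factor (R : realType) (g : lieAlgType R) :=
  forall I : {vspace g}, lie_ideal I -> lie_simple I -> ~ compact_lie I.

(* The real rank is the common dimension of all the Cartan subspaces. *)
Definition is_real_rank (R : realType) (g : lieAlgType R) (r : nat) :=
  forall U : {vspace g}, cartan_subspace U -> \dim U = r.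

Record grassmannian (K : fieldType) (V : vectType K) (r : nat) := Grassmannian {
  gr_space :> {vspace V};
  gr_dim : \dim gr_space == r
}.

HB.instance Definition _ (K : fieldType) (V : vectType K) (r : nat) :=
  [isSub for @gr_space K V r].
HB.instance Definition _ (K : fieldType) (V : vectType K) (r : nat) :=
  [Choice of grassmannian V r by <:].

Section GrassmannianTopology.
Context {R : realType} {V : vectType R} {r : nat}.
Local Notation Gr := (grassmannian V r).
Local Notation N := (\dim (fullv : {vspace V})).

Definition frame_span (M : 'M[R]_(r, N)) : {vspace V} :=
  span [seq \sum_(j < N) M i j *: (vbasis fullv)`_j | i <- enum 'I_r].

(* The quotient topology by [frame_span] of the set of r x N matrices of rank r:
   O is open iff its inverse image is the trace of an open set of matrices.
   A matrix M of rank < r spans no element of the Grassmannian. *)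
Definition gr_open (O : set Gr) := exists2 A : set 'M[R]_(r, N), open A &
  forall (M : 'M[R]_(r, N)) (U : Gr), frame_span M = U -> (A M <-> O U).

Lemma gr_openT : gr_open setT.
Proof. by exists setT => //; exact: openT. Qed.

Lemma gr_openI : setI_closed gr_open.
Proof.
move=> O1 O2 [A1 oA1 h1] [A2 oA2 h2]; exists (A1 `&` A2); first exact: openI.
by move=> M U MU; split=> -[/(h1 _ _ MU) ? /(h2 _ _ MU) ?].
Qed.

Lemma gr_open_bigU (I : Type) (f : I -> set Gr) :
  (forall i, gr_open (f i)) -> gr_open (\bigcup_i f i).
Proof.
move=> fo; have /choice[A hA] : forall i, exists A : set 'M[R]_(r, N),
    open A /\ forall M (U : Gr), frame_span M = U -> (A M <-> f i U).
  by move=> i; have [A oA h] := fo i; exists A.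
exists (\bigcup_i A i); first by apply: bigcup_open => i _; have [] := hA i.
move=> M U MU; split=> -[i _ h]; exists i => //;
  by have [_ /(_ _ _ MU)[h1 h2]] := hA i; auto.
Qed.

HB.instance Definition _ :=
  isOpenTopological.Build Gr gr_openT gr_openI gr_open_bigU.

(* Pluecker coordinates, here indexed by all maps 'I_r -> 'I_N: those of the
   increasing maps determine the others, up to sign. They depend on the choice
   of a basis of U only through a common nonzero scalar. *)
Definition pluecker (U : Gr) (J : {ffun 'I_r -> 'I_N}) : R :=
  \det (\matrix_(i < r, j < r) coord (vbasis fullv) (J j) (vbasis U)`_i).

Definition mpoly_homogeneous (n : nat) (p : mpoly.mpoly n R) :=
  exists d, forall m, mpoly.mcoeff m p != 0 -> mpoly.mdeg m = d.

(* The closed subsets of the projective variety Gr: the zero loci of sets of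
   homogeneous real polynomials in the Pluecker coordinates. *)
Definition zariski_closed (Z : set Gr) :=
  exists2 F : set (mpoly.mpoly #|{ffun 'I_r -> 'I_N}| R),
    (forall p, F p -> mpoly_homogeneous p) &
    Z = [set U | forall p, F p ->
           mpoly.meval (fun k => pluecker U (enum_val k)) p = 0].

End GrassmannianTopology.

Definition Cartan (R : realType) (g : lieAlgType R) (r : nat) :
    set (grassmannian g r) :=
  [set U | cartan_subspace (U : {vspace g})].
Arguments Cartan {R} g r.

(* Main.v *)
From HB Require Import structures.
From mathcomp Require Import all_boot all_order all_algebra.
From mathcomp Require Import complex ring lra zify.
From mathcomp Require Import all_classical all_reals all_analysis.
From mathcomp Require mpoly.
Require Import Defs.
Set Implicit Arguments.
Unset Strict Implicit.
Unset Printing Implicit Defensive.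
Import Order.TTheory GRing.Theory Num.Theory.
Import numFieldNormedType.Exports.
Import passmx.
Local Open Scope classical_set_scope.
Local Open Scope ring_scope.

(** The closure of the set of Cartan subspaces is not algebraic because some
    algebraic curve of the Grassmannian runs inside the set of Cartan subspaces
    for a while and then leaves its closure.

    Let [a] be a Cartan subspace. There is a root of [a] whose kernel [b] in [a]
    is completed by the neutral element [h] of an sl2-triple [(e, h, f)] that
    commutes with [b] ([root_sl2]). Put [U t = b + <[e + t *: f]>]. For [t > 0],
    an automorphism of [g] maps [e + t *: f] to a multiple of [h] and fixes [b]
    ([sl2_conjugate]), so [U t] is a Cartan subspace. The Pluecker coordinates of
    [U t] are polynomials in [t], so an algebraic set that contains [U t] for all
    [t > 0] contains [U (- 1)] ([zariski_closed_line]). But the Killing form is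
    nonnegative on Cartan subspaces, hence on their limits
    ([negative_not_in_closure]), and it is negative at [e - f]
    ([kappa_sl2]).

    It remains to find a nonzero [a] and the triple. The tool for both is the
    real part of an endomorphism [A] ([real_part_op]): the operator [D] that acts
    as [Re l] on the generalized eigenspaces of [A] for [l]. It is a derivation
    when [A] is one ([real_part_derivation]), and the trace of [A D] is that of
    [D^2], a sum of squares. From this and Engel's theorem one gets the
    nondegeneracy of the Killing form [kappa] ([kappa_nondegenerate]), so that
    derivations are inner and each [x] has a hyperbolic part [h] in [g], with
    [kappa x h = kappa h h] ([hyperbolic_part]). If every hyperbolic part is 0,
    the Killing form is negative definite and a minimal ideal is a compact
    factor; so [a] is nonzero ([cartan_neq0]). Moreover an element of the
    centralizer of [a] that is orthogonal to [a] has hyperbolic part 0, hence no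
    nonzero real eigenvalue, and this is what allows to choose, for a root vector
    [e], an opposite root vector [f] such that [lie e f] is in [a]
    ([root_vectors]). *)

(** * Real quadratic factors *)

Section Poly.
Variable R : rcfType.
Local Notation C := (complex R).
Implicit Types (a b c d : R) (s : seq (R * R)) (p q : {poly R}).

(** The real polynomial whose complex roots are [a + i b] and [a - i b]; it is
    not irreducible when [b = 0], which lets real and nonreal eigenvalues be
    treated alike. *)
Definition quad a b : {poly R} := ('X - a%:P) ^+ 2 + (b ^+ 2)%:P.

Lemma horner_quad a b x : (quad a b).[x] = (x - a) ^+ 2 + b ^+ 2.
Proof. by rewrite !hornerE. Qed.

(** The difference of the two quadratics is linear with a real root [x], so a
    common root would be [x], and a real root of [quad a b] can only be [a]. *)
Lemma coprime_quad a b c d : a != c -> coprimep (quad a b) (quad c d).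
Proof.
move=> ac.
(* [k] is the leading coefficient of the difference and [x] its root *)
pose k := c - a + (c - a).
have k0 : k != 0 by rewrite /k -mulr2n mulrn_eq0 //= subr_eq0 eq_sym.
pose x := - (a ^+ 2 + b ^+ 2 - c ^+ 2 - d ^+ 2) / k.
have E : quad a b = quad c d + k%:P * ('X - x%:P).
  have kx : k * x = - (a ^+ 2 + b ^+ 2 - c ^+ 2 - d ^+ 2).
    by rewrite /x mulrC divfK.
  rewrite mulrBr -polyCM kx /quad /k.
  by rewrite !expr2 !(polyCN, polyCD, polyCM, polyCB); ring.
rewrite E coprimep_sym -{2}[quad c d]mul1r coprimep_addl_mul.
rewrite mul_polyC coprimepZr // coprimep_XsubC /root.
apply/negP => /eqP r1.
have r2 : (quad a b).[x] = 0 by rewrite E hornerD r1 add0r !hornerE subrr mulr0.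
move: r1 r2; rewrite !horner_quad => /eqP.
rewrite paddr_eq0 ?sqr_ge0 // !sqrf_eq0 subr_eq0 => /andP[/eqP -> _] /eqP.
rewrite paddr_eq0 ?sqr_ge0 // !sqrf_eq0 subr_eq0 => /andP[/eqP ca _].
by rewrite ca eqxx in ac.
Qed.

(** Over the complex numbers, ['X - z] divides [quad (Re z) (Im z)]. *)
Lemma dvd_prod_quad p : p != 0 -> exists s, p %| \prod_(z <- s) quad z.1 z.2.
Proof.
move=> p0; pose f := real_complex R.
have [r pr] := closed_field_poly_normal (map_poly f p).
exists [seq (complex.Re z, complex.Im z) | z <- r].
rewrite -(dvdp_map f) pr dvdpZl; last first.
  by rewrite lead_coef_eq0 map_poly_eq0.
rewrite rmorph_prod /= big_map.
elim: r {pr} => [|z r IH]; first by rewrite !big_nil dvd1p.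
rewrite !big_cons dvdp_mul // dvdp_XsubCl /root /quad /=.
rewrite rmorphD rmorphXn rmorphB /= map_polyX !map_polyC /= !hornerE.
case: z => a b; apply/eqP; rewrite /f.
have -> : (a +i* b)%C - (a%:C)%C = ('i%C * b%:C)%C :> C by simpc.
rewrite exprMn sqr_i mulN1r -rmorphXn /= ; exact: addNr.
Qed.

Lemma coprime_prod_seq (F : fieldType) (I : eqType) (r : seq I) (P : pred I)
    (f : I -> {poly F}) (q : {poly F}) :
  (forall i, i \in r -> P i -> coprimep (f i) q) ->
  coprimep (\prod_(i <- r | P i) f i) q.
Proof.
move=> h; rewrite big_seq_cond; elim/big_ind: _ => [|p1 p2 h1 h2|i /andP[]].
- exact: coprime1p.
- by rewrite coprimepMl h1.
- exact: h.
Qed.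

Lemma poly_crt (F : fieldType) (T : eqType) (s : seq T) (f : T -> {poly F})
    (c : T -> F) : uniq s ->
    {in s &, forall x y, x != y -> coprimep (f x) (f y)} ->
  exists p : {poly F}, {in s, forall x, f x %| p - (c x)%:P}.
Proof.
elim: s => [|x s IH] /=; first by exists 0.
case/andP=> xs us cop.
have [|p hp] := IH us.
  by move=> y z ys zs; apply: cop; rewrite inE ?ys ?zs orbT.
have /Bezout_eq1_coprimepP[[u v] /= uv] : coprimep (f x) (\prod_(y <- s) f y).
  rewrite coprimep_sym; apply: coprime_prod_seq => y ys _.
  apply: cop; rewrite ?inE ?eqxx ?ys ?orbT //.
  by apply: contraNneq xs => <-.
pose P := \prod_(y <- s) f y.
exists (p * (u * f x) + (c x)%:P * (v * P)) => y.
rewrite inE => /predU1P[->|ys].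
  rewrite [X in _ %| X](_ : _ = (p - (c x)%:P) * u * f x); first exact: dvdp_mulIr.
  have -> : v * P = 1 - u * f x by rewrite -uv addrC addKr.
  by ring.
rewrite [X in _ %| X](_ : _ = (p - (c y)%:P) + ((c x)%:P - p) * v * P).
  by rewrite dvdp_add ?hp // dvdp_mull // /P (big_rem y) //= dvdp_mulIl.
have -> : u * f x = 1 - v * P by rewrite -uv addrK.
by ring.
Qed.

(** The factors for the eigenvalues of real part [a]. *)
Definition quad_part s a : {poly R} := \prod_(z <- s | z.1 == a) quad z.1 z.2.

Lemma coprime_quad_part s a c d : a != c -> coprimep (quad_part s a) (quad c d).
Proof.
by move=> ac; apply: coprime_prod_seq => z _ /eqP ->; apply: coprime_quad.
Qed.

(** By the Chinese remainder theorem some polynomial takes the value [a]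
    modulo each [quad_part s a]; evaluated at a matrix, it replaces every
    eigenvalue by its real part and kills the nilpotent part. *)
Lemma ex_real_part_poly s : exists p, forall a, quad_part s a %| p - a%:P.
Proof.
have [||p hp] := @poly_crt R R (undup [seq z.1 | z <- s]) (quad_part s) id.
- exact: undup_uniq.
- move=> a c _ _ ac; rewrite coprimep_sym; apply: coprime_prod_seq => z _ /eqP ->.
  by rewrite coprimep_sym; apply: coprime_quad_part.
exists p => a; case: (boolP (a \in [seq z.1 | z <- s])) => [|as_].
  by rewrite -mem_undup => /hp.
rewrite /quad_part big_seq_cond big_pred0 ?dvd1p // => z.
by apply/negP => /andP[zs /eqP za]; case/negP: as_; rewrite -za map_f.
Qed.

Lemma prod_quad_part s :
  \prod_(z <- s) quad z.1 z.2 = \prod_(a <- undup [seq z.1 | z <- s]) quad_part s a.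
Proof.
rewrite /quad_part (exchange_big_dep predT) //= big_seq [RHS]big_seq.
apply: eq_bigr => z zs.
rewrite (big_rem z.1) ?mem_undup ?map_f //= eqxx big1_seq ?mulr1 // => a.
rewrite rem_filter ?undup_uniq // mem_filter /= => /andP[/eqP <-].
by rewrite eqxx.
Qed.

End Poly.

(** * Real part of a matrix *)

Section Matrix.
Variable R : rcfType.
Local Notation C := (complex R).
Variable n' : nat.
Local Notation n := n'.+1.
Implicit Types (A D : 'M[R]_n) (p q : {poly R}) (v : 'rV[R]_n).

Lemma horner_mx_trig (F : comNzRingType) (T : 'M[F]_n) (q : {poly F}) : is_trig_mx T ->
  is_trig_mx (horner_mx T q) /\ forall i, horner_mx T q i i = q.[T i i].
Proof.
move=> /is_trig_mxP trT; elim/poly_ind: q => [|q c [/is_trig_mxP IH1 IH2]].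
  by rewrite rmorph0; split=> [|i]; rewrite ?mx0_is_trig // mxE horner0.
rewrite rmorphD rmorphM /= horner_mx_X horner_mx_C; split.
  apply/is_trig_mxP => i j ij; rewrite !mxE big1 ?add0r => [|k _].
    by rewrite -val_eqE /= ltn_eqF.
  have [ik|ki] := ltnP i k; first by rewrite IH1 // mul0r.
  by rewrite trT ?mulr0 // (leq_ltn_trans ki).
move=> i; rewrite !hornerE -IH2 !mxE eqxx mulr1n; congr (_ + _).
rewrite (bigD1 i) //= big1 ?addr0 // => k ki.
have [ik|] := ltnP i k; first by rewrite IH1 // mul0r.
by rewrite leq_eqVlt val_eqE (negPf ki) => /= /trT ->; rewrite mulr0.
Qed.

(** The [l i] are the diagonal coefficients of a complex triangular form of
    [A], so they carry the eigenvalues with their multiplicities. *)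
Lemma spectrum A : exists l : 'I_n -> C,
  [/\ forall q, (\tr (horner_mx A q))%:C%C =
        \sum_i (map_poly (real_complex R) q).[l i],
      forall q, horner_mx A q = 0 -> forall i, (map_poly (real_complex R) q).[l i] = 0 &
      (forall i, l i = 0) -> A ^+ n = 0].
Proof.
pose f := real_complex R; pose A' := map_mx f A.
have [P /unitarymx_unit uP trT] := Schur A' (ltn0Sn n').
set T := conjmx P A' in trT; pose fq (q : {poly R}) := map_poly f q.
have TE (q : {poly C}) : horner_mx T q = P *m horner_mx A' q *m invmx P.
  by rewrite /T conjumx // horner_mx_uconj.
have mapE q : map_mx f (horner_mx A q) = horner_mx A' (fq q) by exact: map_horner_mx.
have hT (q : {poly C}) := horner_mx_trig q trT.
exists (fun i => T i i); split.
- move=> q; have -> : (\tr (horner_mx A q))%:C%C = \tr (map_mx f (horner_mx A q)).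
    by rewrite trace_map_mx.
  rewrite mapE.
  have <- : \tr (horner_mx T (fq q)) = \tr (horner_mx A' (fq q)).
    by rewrite TE mxtrace_mulC mulmxA mulVmx // mul1mx.
  by apply: eq_bigr => i _; rewrite (hT _).2.
- by move=> q q0 i; rewrite -(hT _).2 TE -mapE q0 map_mx0 mulmx0 mul0mx mxE.
move=> l0; have T0 : horner_mx T 'X^n = 0.
  rewrite -(Cayley_Hamilton T) char_poly_trig //; congr horner_mx.
  by rewrite (eq_bigr (fun=> 'X)) ?prodr_const ?card_ord // => i _; rewrite l0 subr0.
apply: (@map_mx_inj _ _ f); rewrite map_mx0.
have <- : horner_mx A ('X^n) = A ^+ n by rewrite rmorphXn /= horner_mx_X.
rewrite mapE /fq rmorphXn /= map_polyX.
by rewrite -[LHS](mulKmx uP) -[P *m _](mulmxKV uP) -TE T0 mul0mx mulmx0.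
Qed.


(** For [f = A - a], the vectors killed by some list [l] are those of the sum of
    the generalized eigenspaces of [A] for the eigenvalues of real part [a]. No
    complex scalar appears, so that the compatibility of these sums with a Lie
    bracket can be proved over the reals. *)
Fixpoint imag_killed (V : lmodType R) (f : V -> V) (l : seq R) (v : V) : Prop :=
  if l is b :: l' then imag_killed f l' (f (f v) + b ^+ 2 *: v) else v = 0.

Lemma imag_killed_horner A a l v :
  imag_killed (fun u => u *m A - a *: u) l v <->
  v *m horner_mx A (\prod_(b <- l) quad a b) = 0.
Proof.
elim: l v => [|b l IH] v /=; first by rewrite big_nil rmorph1 mulmx1.
rewrite IH big_cons rmorphM /= mulmxA; suff -> : v *m horner_mx A (quad a b) =
  (v *m A - a *: v) *m A - a *: (v *m A - a *: v) + b ^+ 2 *: v by [].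
rewrite rmorphD rmorphXn rmorphB /= horner_mx_X !horner_mx_C mulmxDr.
rewrite mul_mx_scalar expr2 -[_ * _]/(_ *m _) mulmxA mulmxBr mul_mx_scalar.
by rewrite mulmxBr mul_mx_scalar.
Qed.

(** On the kernel of [h] in a module killed by [f * G], the factor [G] is
    invertible, so [f] already kills. *)
Lemma killed_dvd A v (f G h g : {poly R}) : horner_mx A (f * G) = 0 ->
  coprimep h G -> v *m horner_mx A h = 0 -> f %| g -> v *m horner_mx A g = 0.
Proof.
move=> fG /Bezout_eq1_coprimepP[[u w] /= uw] vh /dvdpP[k ->].
have hM p q : horner_mx A (p * q) = horner_mx A p *m horner_mx A q.
  by rewrite rmorphM.
rewrite -[v]mulmx1 -[1%:M](rmorph1 (horner_mx A)) -uw rmorphD /= mulmxDr.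
rewrite [u * h]mulrC !hM !mulmxA vh !mul0mx add0r -!mulmxA -!hM.
rewrite (_ : w * _ = w * k * (f * G)); last by ring.
by rewrite hM fG !mulmx0.
Qed.

(** [D] is the polynomial of [ex_real_part_poly] evaluated at [A]. In a
    triangular form its diagonal consists of the real parts of the diagonal of
    [A], which gives the two trace properties: [A *m D] has the same trace
    as [D *m D], namely [\sum_i (Re (l i)) ^+ 2], and if all eigenvalues are
    imaginary, the trace of [A *m A] is [- \sum_i (Im (l i)) ^+ 2]. *)
Lemma real_part_mx_succ A : exists D : 'M[R]_n,
 [/\ forall B, comm_mx A B -> comm_mx D B,
     diagonalizable D,
     forall v a, v *m D = a *: v <-> exists l, imag_killed (fun u => u *m A - a *: u) l v,
     \tr (A *m D) = \tr (D *m D) &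
     D = 0 -> \tr (A *m A) <= 0 /\
       (\tr (A *m A) = 0 -> exists k, forall v, iter k (mulmx^~ A) v = 0)].
Proof.
have [s sA] := dvd_prod_quad (monic_neq0 (char_poly_monic A)).
have {sA} sA : horner_mx A (\prod_(z <- s) quad z.1 z.2) = 0.
  by case/dvdpP: sA => q ->; rewrite rmorphM /= Cayley_Hamilton mulr0.
have [p hp] := ex_real_part_poly s.
pose G a := \prod_(z <- s | z.1 != a) quad z.1 z.2.
have FE a : \prod_(z <- s) quad z.1 z.2 = quad_part s a * G a.
  by rewrite (bigID (fun z => z.1 == a)).
have vD v a : v *m horner_mx A (p - a%:P) = v *m horner_mx A p - a *: v.
  by rewrite rmorphB /= horner_mx_C mulmxBr mul_mx_scalar.
have [l [trl rtl nil]] := spectrum A.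
have lE i : (map_poly (real_complex R) p).[l i] = (complex.Re (l i))%:C%C.
  have /eqP := rtl _ sA i; rewrite rmorph_prod /= horner_prod prodf_seq_eq0.
  case/hasP=> z zs /= /eqP z0.
  have /dvdpP[k pE] : quad z.1 z.2 %| p - (z.1)%:P.
    apply: dvdp_trans (hp _); rewrite /quad_part (big_rem z) //= eqxx; exact: dvdp_mulIl.
  have -> : p = k * quad z.1 z.2 + (z.1)%:P by rewrite -pE subrK.
  rewrite rmorphD rmorphM /= hornerD hornerM z0 mulr0 add0r map_polyC hornerC.
  congr (_ %:C)%C; move: z0; rewrite rmorphD rmorphXn rmorphB /=.
  rewrite map_polyX !map_polyC !hornerE /=; case: (l i) => x y; case: z {zs pE} => a b /=.
  move=> h; have {h} : (x - a) * (x - a) - y * y = - b ^+ 2 /\ (x - a) * y = 0.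
    move: h; rewrite expr2; simpc => /eqP; rewrite eq_complex /=.
    by move=> /andP[/eqP h1 /eqP h2]; split; lra.
  case=> h1 /eqP; rewrite mulf_eq0 subr_eq0 => /orP[/eqP-> //|/eqP y0].
  have : (x - a) ^+ 2 + b ^+ 2 = 0 by rewrite -[b ^+ 2]opprK -h1 y0; ring.
  move/eqP; rewrite paddr_eq0 ?sqr_ge0 // sqrf_eq0 subr_eq0.
  by case/andP => /eqP ->.
have trR q : \tr (horner_mx A q) = \sum_i complex.Re (map_poly (real_complex R) q).[l i].
  by have /(congr1 (@complex.Re R)) /= -> := trl q; rewrite raddf_sum.
exists (horner_mx A p); split.
- by move=> B; apply: comm_horner_mx.
- apply/diagonalizableP; exists (undup [seq z.1 | z <- s]); first exact: undup_uniq.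
  apply: mxminpoly_min; rewrite rmorph_prod /=.
  rewrite (eq_bigr (fun a => horner_mx A (p - a%:P))) => [|a _]; last first.
    by rewrite !rmorphB /= horner_mx_X !horner_mx_C.
  rewrite -rmorph_prod /=.
  have /dvdpP[k ->] : \prod_(z <- s) quad z.1 z.2 %|
      \prod_(a <- undup [seq z.1 | z <- s]) (p - a%:P).
    rewrite prod_quad_part; elim: (undup _) => [|a r IH]; first by rewrite !big_nil.
    by rewrite !big_cons dvdp_mul.
  by rewrite rmorphM /= sA mulr0.
- move=> v a; split=> [va|[m]].
    exists [seq z.2 | z <- s & z.1 == a]; apply/imag_killed_horner.
    rewrite big_map big_filter.
    rewrite (_ : \prod_(i <- s | _) _ = quad_part s a); last first.
      by apply: eq_bigr => z /eqP ->.
    apply: (@killed_dvd A v (quad_part s a) (G a) (p - a%:P)) => //; first by rewrite -FE.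
      rewrite coprimep_sym; apply: coprime_prod_seq => z zs za.
      apply: (@coprimep_dvdr _ (p - z.1%:P)).
        apply: dvdp_trans (hp _); rewrite /quad_part (big_rem z) //= eqxx.
        exact: dvdp_mulIl.
      apply/Bezout_eq1_coprimepP; exists (((a - z.1)^-1)%:P, - ((a - z.1)^-1)%:P) => /=.
      rewrite mulNr -mulrBr (_ : _ - _ = (a - z.1)%:P) ?rmorphB /=; last by ring.
      by rewrite -rmorphB -polyCM mulVf // subr_eq0 eq_sym.
    by rewrite vD va subrr.
  move/imag_killed_horner => vm; apply/eqP; rewrite -subr_eq0 -vD; apply/eqP.
  apply: (@killed_dvd A v (quad_part s a) (G a)) vm (hp a); first by rewrite -FE.
  apply: coprime_prod_seq => b _ _; rewrite coprimep_sym.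
  by apply: coprime_prod_seq => z _ za; apply: coprime_quad.
- rewrite -[horner_mx A p *m _]rmorphM -[X in X *m _](horner_mx_X A).
  rewrite -[horner_mx A 'X *m _]rmorphM !trR; apply: eq_bigr => i _.
  rewrite !rmorphM /= map_polyX !hornerM hornerX lE.
  by case: (l i) => x y; simpc.
move=> D0; have l0 i : complex.Re (l i) = 0.
  by have := rtl _ D0 i; rewrite lE => /complexI.
have AA : \tr (A *m A) = - \sum_i complex.Im (l i) ^+ 2.
  rewrite -[X in X *m _](horner_mx_X A) -[X in _ *m X](horner_mx_X A).
  rewrite -[horner_mx A 'X *m _]rmorphM !trR -sumrN; apply: eq_bigr => i _.
  rewrite !rmorphM /= map_polyX !hornerM hornerX.
  by move: (l0 i); case: (l i) => x y /= ->; simpc; rewrite /= expr2; ring.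
split; first by rewrite AA oppr_le0 sumr_ge0 // => i _; apply: sqr_ge0.
rewrite AA => /eqP; rewrite oppr_eq0 psumr_eq0 => [/allP h|i _]; last exact: sqr_ge0.
exists n => v; have An : A ^+ n = 0.
  apply: nil => i; have := h i; rewrite mem_index_enum sqrf_eq0 /= => /(_ isT) /eqP.
  by move: (l0 i); case: (l i) => x y /= -> ->.
have iterE k : iter k (mulmx^~ A) v = v *m A ^+ k.
  elim: k => [|k /= ->]; first by rewrite expr0 mulmx1.
  by rewrite exprSr mulmxA.
by rewrite iterE An mulmx0.
Qed.

End Matrix.

Lemma real_part_mx (R : rcfType) n (A : 'M[R]_n) : exists D : 'M[R]_n,
 [/\ forall B, comm_mx A B -> comm_mx D B,
     diagonalizable D,
     forall (v : 'rV_n) a,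
       v *m D = a *: v <-> exists l, imag_killed (fun u => u *m A - a *: u) l v,
     \tr (A *m D) = \tr (D *m D) &
     D = 0 -> \tr (A *m A) <= 0 /\
       (\tr (A *m A) = 0 -> exists k, forall v : 'rV_n, iter k (mulmx^~ A) v = 0)].
Proof.
case: n A => [|n] A; last exact: real_part_mx_succ.
exists 0; split=> //.
- by move=> B _; rewrite /comm_mx !thinmx0.
- exact: diagonalizable0.
- by move=> v a; split=> _; [exists [::]; apply: thinmx0 | rewrite !thinmx0].
- by rewrite !thinmx0.
by move=> _; rewrite !thinmx0 linear0; split=> // _; exists 0%N => v; apply: thinmx0.
Qed.

(** * Trace and diagonalizability of endomorphisms *)

Section Operators.
Variables (K : fieldType) (V : vectType K).
Implicit Types (f h : 'End(V)) (u v : V) (b : seq V).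
Local Notation E := (vbasis {:V}).
Local Notation N := (\dim {:V}).
Local Notation rv := (rVof E).

Let EP : basis_of {:V} E := vbasisP {:V}.

Definition op_mx f : 'M[K]_N := mxof E E f.
Definition op_tr f : K := \tr (op_mx f).

Lemma op_mx_app f v : rv (f v) = rv v *m op_mx f.
Proof. exact: rVof_app. Qed.

Lemma op_mx_comp f h : op_mx (f \o h)%VF = op_mx h *m op_mx f.
Proof. exact: mxof_comp. Qed.

Lemma op_mx_inj : injective op_mx.
Proof. exact: can_inj (mxofK EP EP). Qed.

Lemma op_trD f h : op_tr (f + h) = op_tr f + op_tr h.
Proof. by rewrite /op_tr /op_mx !linearD. Qed.

Lemma op_trB f h : op_tr (f - h) = op_tr f - op_tr h.
Proof. by rewrite /op_tr /op_mx !linearB. Qed.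

Lemma op_trZ a f : op_tr (a *: f) = a * op_tr f.
Proof. by rewrite /op_tr /op_mx !linearZ. Qed.

Lemma op_trC f h : op_tr (f \o h)%VF = op_tr (h \o f)%VF.
Proof. by rewrite /op_tr !op_mx_comp mxtrace_mulC. Qed.

(** Both sides are traces of the two products of the same pair of matrices,
    which factor [f] through [I]. *)
Lemma op_tr_sub f (I : {vspace V}) : (forall v, f v \in I) ->
  op_tr f = \sum_(i < \dim I) coord (vbasis I) i (f (vbasis I)`_i).
Proof.
move=> fI; pose A := \matrix_(i < N, k < \dim I) coord (vbasis I) k (f E`_i).
pose B := \matrix_(k < \dim I, j < N) coord E j (vbasis I)`_k.
have -> : op_tr f = \tr (A *m B).
  congr (\tr _); apply/row_matrixP => i; rewrite rowE -(rVofE EP) -op_mx_app.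
  apply/rowP => j; rewrite !mxE [f _ in LHS](coord_vbasis (fI _)) linear_sum /=.
  by apply: eq_bigr => k _; rewrite linearZ !mxE.
rewrite mxtrace_mulC; apply: eq_bigr => k _; rewrite !mxE.
rewrite [in RHS](coord_vbasis (memvf (vbasis I)`_k)) !linear_sum /=.
by apply: eq_bigr => i _; rewrite !linearZ !mxE.
Qed.

Definition diag_on b f := forall v, v \in b -> exists a, f v = a *: v.

Lemma diag_on_mx f (P : 'M[K]_N) : P \in unitmx -> similar_diag P (op_mx f) ->
  diag_on [seq vecof E (row i P) | i <- enum 'I_N] f.
Proof.
move=> uP /similar_diagPex[d /similarP -/(_ uP) dP] _ /mapP[i _ ->].
exists (d 0 i); apply: (can_inj (rVofK EP)).
rewrite op_mx_app linearZ /= vecofK // -row_mul dP row_mul row_diag_mx.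
by rewrite -scalemxAl -rowE.
Qed.

Lemma basis_mx (P : 'M[K]_N) : P \in unitmx ->
  basis_of {:V} [seq vecof E (row i P) | i <- enum 'I_N].
Proof.
move=> uP; rewrite basisEdim size_map size_enum_ord leqnn andbT.
apply/subvP => v _; rewrite -[v](rVofK EP) -[rv v](mulmxKV uP) mulmx_sum_row.
rewrite linear_sum; apply: memv_suml => i _; rewrite linearZ memvZ //=.
by apply/memv_span/mapP; exists i; rewrite ?mem_enum.
Qed.

Lemma mx_basis b : basis_of {:V} b -> exists2 P : 'M[K]_N, P \in unitmx &
  forall f, diag_on b f -> similar_diag P (op_mx f).
Proof.
move=> bP; have sb : size b == N by rewrite eq_sym (size_basis (X := in_tuple b)).
pose X := Tuple sb; have XP : basis_of {:V} X by [].
pose P : 'M[K]_N := \matrix_i rv X`_i.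
have uP : P \in unitmx.
  rewrite -row_free_unit; apply/inj_row_free => c c0.
  have := basis_free XP => /freeP h; apply/rowP => i; rewrite mxE.
  apply: h; apply: (can_inj (rVofK EP)); rewrite linear0 -[RHS]c0 mulmx_sum_row linear_sum.
  by apply: eq_bigr => j _; rewrite linearZ rowK.
exists P => // f fb.
have [d dP] : exists d : 'I_N -> K, forall i : 'I_N, f X`_i = d i *: X`_i.
  apply: (@fin_all_exists _ (fun=> K) (fun (i : 'I_N) a => f X`_i = a *: X`_i)) => i.
  by apply: fb; apply: mem_nth; rewrite (eqP sb).
apply/similar_diagPex; exists (\row_i d i); apply/similarP => //.
apply/row_matrixP => i; rewrite !row_mul row_diag_mx -scalemxAl -rowE mxE rowK.
by rewrite -op_mx_app dP linearZ.
Qed.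

Definition diagonalizable_op f := exists2 b, basis_of {:V} b & diag_on b f.

Lemma diagonalizable_opP f : diagonalizable_op f <-> diagonalizable (op_mx f).
Proof.
split=> [[b bP fb]|[P uP dP]].
  by have [P uP h] := mx_basis bP; exists P => //; apply: h.
by eexists; [exact: basis_mx uP | exact: diag_on_mx].
Qed.

Lemma codiagonalizable_op (fs : seq 'End(V)) :
  {in fs &, forall f h, (f \o h)%VF = (h \o f)%VF} ->
  {in fs, forall f, diagonalizable_op f} ->
  exists2 b, basis_of {:V} b & {in fs, forall f, diag_on b f}.
Proof.
move=> comm dg; have /codiagonalizableP[P uP /allP/= h] :
  {in map op_mx fs &, forall A B, comm_mx A B} /\
  {in map op_mx fs, forall A, diagonalizable A}.
  split=> [_ _ /mapP[f ffs ->] /mapP[h hfs ->]|_ /mapP[f ffs ->]].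
    by rewrite /comm_mx -!op_mx_comp comm.
  exact/diagonalizable_opP/dg.
exists [seq vecof E (row i P) | i <- enum 'I_N]; first exact: basis_mx.
by move=> f ffs; apply: diag_on_mx => //; apply: h; apply: map_f.
Qed.

Lemma diag_op_tr f : diagonalizable_op f -> exists d : 'I_N -> K,
  op_tr (f \o f)%VF = \sum_i d i ^+ 2 /\ ((forall i, d i = 0) -> f = 0).
Proof.
move=> /diagonalizable_opP[P uP /similar_diagPex[d /similarLR -/(_ uP)]].
rewrite conjVmx // => fE; exists (d 0); split.
  rewrite /op_tr op_mx_comp fE !mulmxA mulmxK // -mulmxA mxtrace_mulC.
  rewrite -!mulmxA mulKVmx // mulmx_diag mxtrace_diag.
  by apply: eq_bigr => i _; rewrite mxE expr2.
move=> d0; apply: op_mx_inj; rewrite /op_mx linear0 -/(op_mx f) fE.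
have -> : d = 0 by apply/rowP => i; rewrite d0 mxE.
by rewrite linear0 mulmx0 mul0mx.
Qed.

End Operators.

Section RealOperators.
Variables (R : rcfType) (V : vectType R).
Implicit Types (f h D : 'End(V)) (u v : V).
Local Notation E := (vbasis {:V}).
Local Notation N := (\dim {:V}).
Local Notation rv := (rVof E).

Let EP : basis_of {:V} E := vbasisP {:V}.

Lemma diag_op_tr_ge0 f : diagonalizable_op f -> 0 <= op_tr (f \o f)%VF.
Proof. by case/diag_op_tr => d [-> _]; apply: sumr_ge0 => i _; apply: sqr_ge0. Qed.

Lemma diag_op_tr_eq0 f : diagonalizable_op f -> op_tr (f \o f)%VF = 0 -> f = 0.
Proof.
case/diag_op_tr => d [-> h] /eqP; rewrite psumr_eq0 => [/allP h0|i _]; last exact: sqr_ge0.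
by apply: h => i; have := h0 i; rewrite mem_index_enum sqrf_eq0 => /(_ isT)/eqP.
Qed.

Lemma imag_killed_rv f a l v :
  imag_killed (fun u => f u - a *: u) l v <->
  imag_killed (fun u : 'rV_N => u *m op_mx f - a *: u) l (rv v).
Proof.
have rg u : rv (f u - a *: u) = rv u *m op_mx f - a *: rv u.
  by rewrite linearB linearZ /= op_mx_app.
elim: l v => [|b l IH] v /=.
  by split=> [->|/eqP]; rewrite ?linear0 // rVof_eq0 // => /eqP.
rewrite IH; set w := f v - a *: v.
have -> : rv (f w - a *: w + b ^+ 2 *: v) = rv (f w - a *: w) + b ^+ 2 *: rv v.
  by rewrite addrC rVof_linear addrC.
by rewrite !rg.
Qed.

(** The real part of an endomorphism: it acts as [a] on the sum of the
    generalized eigenspaces for the eigenvalues of real part [a]. *)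
Lemma real_part_op f : exists D : 'End(V),
 [/\ forall h, (f \o h = h \o f)%VF -> (D \o h = h \o D)%VF,
     diagonalizable_op D,
     forall v a, D v = a *: v <-> exists l, imag_killed (fun u => f u - a *: u) l v,
     op_tr (f \o D)%VF = op_tr (D \o D)%VF &
     D = 0 -> op_tr (f \o f)%VF <= 0 /\
       (op_tr (f \o f)%VF = 0 -> exists k, forall v, iter k f v = 0)].
Proof.
have [M [cM dM kM tM zM]] := real_part_mx (op_mx f).
pose D : 'End(V) := hommx E E M.
have DE : op_mx D = M by exact: (hommxK EP EP).
exists D; split.
- move=> h fh; apply: op_mx_inj; rewrite !op_mx_comp DE; apply/esym/cM.
  by rewrite /comm_mx -!op_mx_comp fh.
- by apply/diagonalizable_opP; rewrite DE.
- move=> v a; split=> [Dv|[l /imag_killed_rv vl]].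
    have /(kM (rv v) a).1[l vl] : rv v *m M = a *: rv v.
      by rewrite -DE -op_mx_app Dv linearZ.
    by exists l; apply/imag_killed_rv.
  apply: (can_inj (rVofK EP)); rewrite op_mx_app DE linearZ /=.
  by apply/kM; exists l.
- by rewrite op_trC /op_tr !op_mx_comp DE.
move=> D0; have M0 : M = 0 by rewrite -DE D0 /op_mx linear0.
have [tle t0] := zM M0; rewrite /op_tr op_mx_comp; split=> // /t0[k kP].
exists k => v; apply: (can_inj (rVofK EP)); rewrite linear0 -[RHS](kP (rv v)).
by elim: k {kP} => //= k IH; rewrite op_mx_app IH.
Qed.

End RealOperators.

(** * Subspaces and linear forms *)

Section Subspaces.
Variables (K : fieldType) (V : vectType K).

Lemma ex_max_vspace (P : {vspace V} -> Prop) U0 : P U0 ->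
  exists2 U, P U & forall W, P W -> (\dim W <= \dim U)%N.
Proof.
move=> P0; pose Q k := `[< exists2 U, P U & \dim U = k >].
have exQ : exists k, Q k by exists (\dim U0); apply/asboolP; exists U0.
have leQ k : Q k -> (k <= \dim {:V})%N.
  by move=> /asboolP[U _ <-]; apply/dimvS/subvf.
case: (ex_maxnP exQ leQ) => k /asboolP[U PU <-] h; exists U => // W PW.
by apply: h; apply/asboolP; exists W.
Qed.

Lemma ex_min_vspace (P : {vspace V} -> Prop) U0 : P U0 ->
  exists2 U, P U & forall W, P W -> (\dim U <= \dim W)%N.
Proof.
move=> P0; pose Q k := `[< exists2 U, P U & \dim U = k >].
have exQ : exists k, Q k by exists (\dim U0); apply/asboolP; exists U0.
case: (ex_minnP exQ) => k /asboolP[U PU <-] h; exists U => // W PW.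
by apply: h; apply/asboolP; exists W.
Qed.

(** A subspace of maximal dimension among those contained in [P] is all of
    [P]. *)
Lemma vspace_of_pred (P : V -> Prop) : P 0 ->
    (forall k u v, P u -> P v -> P (k *: u + v)) ->
  exists U : {vspace V}, forall x, x \in U <-> P x.
Proof.
move=> P0 PD; have [|U PU maxU] := @ex_max_vspace (fun U => forall x, x \in U -> P x) 0%VS.
  by move=> x; rewrite memv0 => /eqP ->.
exists U => x; split; first exact: PU.
move=> Px; have PW : forall y, y \in (U + <[x]>)%VS -> P y.
  move=> y /memv_addP[u uU [_ /vlineP[k ->] ->]].
  by rewrite addrC; apply: PD => //; apply: PU.
have /eqP -> : U == (U + <[x]>)%VS by rewrite eqEdim addvSl maxU.
by apply: (subvP (addvSr _ _)); rewrite memv_line.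
Qed.

Lemma cap_line (U : {vspace V}) x : x \notin U -> (<[x]> :&: U = 0)%VS.
Proof.
move=> xU; apply/eqP; rewrite -subv0; apply/subvP => y /memv_capP[/vlineP[k ->] kU].
rewrite memv0 scaler_eq0; apply: contraNT xU; rewrite negb_or => /andP[k0 _].
by rewrite -[x](scalerK k0) memvZ.
Qed.

Lemma dim_add_line (U : {vspace V}) x :
  x \notin U -> \dim (U + <[x]>)%VS = (\dim U).+1.
Proof.
move=> xU; have x0 : x != 0 by apply: contraNneq xU => ->; apply: mem0v.
by rewrite dimv_disjoint_sum ?dim_vline ?x0 ?addn1 // capvC cap_line.
Qed.

Lemma separating_form (U : {vspace V}) x : x \notin U ->
  exists2 phi : {linear V -> K^o}, phi x = 1 & forall u, u \in U -> phi u = 0.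
Proof.
move=> xU; have x0 : x != 0 by apply: contraNneq xU => ->; apply: mem0v.
have dxU := cap_line xU.
pose p := daddv_pi <[x]> U.
have fx : free [tuple x] by rewrite seq1_free.
exists (GRing.Linear.clone _ _ _ _ (coord [tuple x] 0 \o p) _) => /=.
  rewrite /p daddv_pi_id ?memv_line //.
  exact: (coord_free ord0 ord0 fx).
move=> u uU; suff -> : p u = 0 by rewrite linear0.
have uS : u \in (<[x]> + U)%VS by apply: (subvP (addvSr _ _)).
have := daddv_pi_add dxU uS; rewrite [daddv_pi U _ u]daddv_pi_id 1?capvC //.
by rewrite -[RHS]add0r => /addIr.
Qed.

End Subspaces.

(** * The bracket and the Killing form *)

Section LieBasics.
Variables (R : realType) (g : lieAlgType R).
Implicit Types (x y z : g).

HB.instance Definition _ x := GRing.isLinear.Build R g g _ (lie x) (lie_linearr x).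

Definition ad x : 'End(g) := linfun (lie x).

Lemma adE x y : ad x y = lie x y. Proof. exact: lfunE. Qed.

Lemma lieDl x y z : lie (x + y) z = lie x z + lie y z.
Proof. by have := lie_linearl z 1 x y; rewrite /= !scale1r. Qed.

Lemma lie0l z : lie 0 z = 0.
Proof. by apply: (addrI (lie 0 z)); rewrite -lieDl !addr0. Qed.

Lemma lieZl a x z : lie (a *: x) z = a *: lie x z.
Proof. by have := lie_linearl z a x 0; rewrite /= lie0l !addr0. Qed.

Lemma lieDr x y z : lie x (y + z) = lie x y + lie x z.
Proof. exact: linearD. Qed.

Lemma lieZr a x z : lie x (a *: z) = a *: lie x z.
Proof. exact: linearZ. Qed.

Lemma lieNl x z : lie (- x) z = - lie x z.
Proof. by apply/eqP; rewrite -addr_eq0 -lieDl addNr lie0l. Qed.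

Lemma lieNr x z : lie x (- z) = - lie x z.
Proof. exact: linearN. Qed.

Lemma lieC x y : lie x y = - lie y x.
Proof.
have := lie_alt (x + y); rewrite lieDl !lieDr !lie_alt add0r addr0 => /eqP.
by rewrite addr_eq0 => /eqP.
Qed.

Lemma lie_der x y z : lie x (lie y z) = lie (lie x y) z + lie y (lie x z).
Proof.
have := lie_jacobi x y z; rewrite [lie z x]lieC [lie z (lie x y)]lieC linearN => /eqP.
by rewrite subr_eq0 => /eqP <-; rewrite addrNK.
Qed.

Lemma ad_linear : linear ad.
Proof.
move=> a x y; apply/lfunP => z.
by rewrite add_lfunE scale_lfunE !adE lieDl lieZl.
Qed.
HB.instance Definition _ := GRing.isLinear.Build R g 'End(g) _ ad ad_linear.

Lemma ad_lie x y : ad (lie x y) = ((ad x \o ad y) - (ad y \o ad x))%VF.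
Proof.
apply/lfunP => z; rewrite add_lfunE opp_lfunE !comp_lfunE !adE.
by rewrite [lie x (lie y z)]lie_der addrK.
Qed.

Definition kappa x y : R := op_tr (ad x \o ad y)%VF.

Lemma kappaC x y : kappa x y = kappa y x. Proof. exact: op_trC. Qed.

Lemma kappaDl x y z : kappa (x + y) z = kappa x z + kappa y z.
Proof. by rewrite /kappa linearD /= comp_lfunDl op_trD. Qed.

Lemma kappaZl a x y : kappa (a *: x) y = a * kappa x y.
Proof. by rewrite /kappa linearZ /= -comp_lfunZl op_trZ. Qed.

Lemma kappaDr x y z : kappa x (y + z) = kappa x y + kappa x z.
Proof. by rewrite !(kappaC x) kappaDl. Qed.

Lemma kappaZr a x y : kappa x (a *: y) = a * kappa x y.
Proof. by rewrite !(kappaC x) kappaZl. Qed.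

Lemma kappa_linear x : linear (kappa x : g -> R^o).
Proof. by move=> a y z; rewrite kappaDr kappaZr. Qed.
HB.instance Definition _ x := GRing.isLinear.Build R g R^o _ (kappa x) (kappa_linear x).

Lemma kappa0l y : kappa 0 y = 0. Proof. by rewrite kappaC linear0. Qed.
Lemma kappaNl x y : kappa (- x) y = - kappa x y.
Proof. by rewrite -scaleN1r kappaZl mulN1r. Qed.

Lemma op_tr_invariant (f h k : 'End(g)) :
  op_tr (((f \o h) - (h \o f)) \o k)%VF = op_tr (f \o ((h \o k) - (k \o h)))%VF.
Proof.
rewrite comp_lfunDl comp_lfunDr comp_lfunNl comp_lfunNr !op_trB.
by rewrite -!comp_lfunA [op_tr (h \o _)%VF]op_trC -comp_lfunA.
Qed.

Lemma kappa_lie x y z : kappa (lie x y) z = kappa x (lie y z).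
Proof. by rewrite /kappa !ad_lie op_tr_invariant. Qed.

(** Riesz representation on a subspace where the Killing form is
    nondegenerate: the Gram matrix of a basis is invertible. *)
Lemma kappa_riesz (U : {vspace g}) (phi : {linear g -> R^o}) :
    (forall u, u \in U -> (forall w, w \in U -> kappa u w = 0) -> u = 0) ->
  exists2 u, u \in U & forall w, w \in U -> kappa u w = phi w.
Proof.
move=> ndg; pose X := vbasis U; pose d := \dim U.
pose G := \matrix_(i < d, j < d) kappa X`_i X`_j.
have kX (c : 'rV_d) (j : 'I_d) : kappa (\sum_i c 0 i *: X`_i) X`_j = (c *m G) 0 j.
  rewrite kappaC linear_sum mxE; apply: eq_bigr => i _.
  by rewrite linearZ /= mxE kappaC.
have XU (c : 'rV_d) : \sum_i c 0 i *: X`_i \in U.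
  by apply: memv_suml => i _; rewrite memvZ // vbasis_mem // mem_nth // size_tuple.
have ext u (psi : {linear g -> R^o}) : (forall j : 'I_d, kappa u X`_j = psi X`_j) ->
    forall w, w \in U -> kappa u w = psi w.
  move=> h w wU; rewrite (coord_vbasis wU) !linear_sum; apply: eq_bigr => i _.
  by rewrite !linearZ /= h.
have uG : G \in unitmx.
  rewrite -row_free_unit; apply/inj_row_free => c c0.
  have /freeP h := basis_free (vbasisP U); apply/rowP => i; rewrite mxE.
  apply: h; apply: (ndg _ (XU c)) => w.
  by apply: (ext _ \0) => j; rewrite kX c0 mxE.
pose c := (\row_j (phi X`_j : R)) *m invmx G.
exists (\sum_i c 0 i *: X`_i) => // w.
by apply: ext => j; rewrite kX mulmxKV // mxE.
Qed.

End LieBasics.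

(** * Engel's theorem *)

Section Engel.
Variables (R : realType) (g : lieAlgType R).
Implicit Types (x y z : g) (I J M U W : {vspace g}).

Definition ad_nilpotent x := exists k, forall y, iter k (lie x) y = 0.

Definition lie_subalgebra M := forall x y, x \in M -> y \in M -> lie x y \in M.

Definition lie_stable M U := forall x u, x \in M -> u \in U -> lie x u \in U.

Lemma subalgebra_add_line M y : lie_subalgebra M ->
  (forall x, x \in M -> lie x y \in M) -> lie_subalgebra (M + <[y]>)%VS.
Proof.
move=> sM My _ _ /memv_addP[u uM [_ /vlineP[a ->] ->]] /memv_addP[v vM [_ /vlineP[b ->] ->]].
apply: (subvP (addvSl M <[y]>)).
rewrite lieDl !lieDr !lieZl !lieZr lie_alt !scaler0 addr0 [lie y v]lieC.
by rewrite !memvD ?memvZ ?memvN ?My ?sM.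
Qed.

(** Engel's theorem on a quotient: applied to [W / U], it gives a nonzero vector
    killed by [M]. Stating it with a pair [U], [W] lets the induction use it both
    for the action of a maximal proper subalgebra [M'] on [M / M'], which shows
    that [M'] has codimension 1 and is an ideal, and for the action of [M'] on
    [W / U]. *)
Lemma engel M U W : lie_subalgebra M -> (forall x, x \in M -> ad_nilpotent x) ->
    lie_stable M U -> lie_stable M W -> ~~ (W <= U)%VS ->
  exists2 w, w \in W & w \notin U /\ forall x, x \in M -> lie x w \in U.
Proof.
have [n] := ubnP (\dim M); elim: n M U W => // n IH K U W dK sK nK KU KW WU.
have [K0|K0] := eqVneq K 0%VS.
  have [w wW wU] := subvPn WU; exists w => //; split=> // x.
  by rewrite K0 memv0 => /eqP ->; rewrite lie0l mem0v.
(* a maximal proper subalgebra of [K] *)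
pose P M := [/\ (M <= K)%VS, ~~ (K <= M)%VS & lie_subalgebra M].
have P0 : P 0%VS.
  split; rewrite ?sub0v ?subv0 // => x y; rewrite !memv0 => /eqP -> _.
  by rewrite lie0l.
have [M [MK KM sM] maxM] := ex_max_vspace P0.
have dM : (\dim M < n)%N.
  apply: leq_trans (dK : \dim K <= n)%N.
  by rewrite ltn_neqAle (dimv_leqif_sup MK) KM dimvS.
have nM x : x \in M -> ad_nilpotent x by move=> xM; apply/nK/(subvP MK).
have [y yK [yM My]] : exists2 w, w \in K & w \notin M /\ forall x, x \in M -> lie x w \in M.
  by apply: IH => // x u xM uK; apply: sK => //; apply: (subvP MK).
have KE : (K <= M + <[y]>)%VS.
  apply: contraT => KMy; have : P (M + <[y]>)%VS.
    by split=> //; [rewrite subv_add MK -memvE | apply: subalgebra_add_line].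
  move/maxM; rewrite leqNgt ltn_neqAle (dimv_leqif_sup (addvSl _ _)) dimvS ?addvSl //.
  by rewrite subv_add subvv -memvE yM.
have [w0 w0W [w0U Mw0]] : exists2 w, w \in W & w \notin U /\ forall x, x \in M -> lie x w \in U.
  by apply: IH => // x u xM; [apply: KU | apply: KW]; apply: (subvP MK).
have stab k : iter k (lie y) w0 \in W /\ forall x, x \in M -> lie x (iter k (lie y) w0) \in U.
  elim: k => //= k [IW IM]; split; first exact: KW.
  by move=> x xM; rewrite lie_der memvD //; [apply/IM/My | apply/KU/IM].
have [k0 k0P] := nK _ yK.
(* the last iterate outside [U] is killed by [y] modulo [U], and still by [M] *)
have exk : exists k, iter k (lie y) w0 \in U by exists k0; rewrite k0P mem0v.
case: (ex_minnP exk) => -[|k] kU mink; first by rewrite kU in w0U.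
have [IW IM] := stab k.
exists (iter k (lie y) w0) => //; split.
  by apply: contraL (leqnn k.+1) => /mink; rewrite -ltnNge ltnS.
move=> x /(subvP KE)/memv_addP[u uM [_ /vlineP[a ->] ->]].
rewrite iterS in kU.
by rewrite lieDl lieZl memvD ?memvZ ?(IM _ uM) ?kU.
Qed.

Hypothesis ss : semisimple g.

Lemma abelian_ideal0 I : lie_ideal I -> lie_abelian I -> I = 0%VS.
Proof.
move=> iI aI; apply: ss => //; exists 1%N => /=; apply/eqP; rewrite -subv0.
apply/span_subvP => _ /allpairsP[[x y] /= [xI yI ->]].
by rewrite aI ?mem0v // vbasis_mem.
Qed.

Lemma lie_idealP I : (forall x y, y \in I -> lie x y \in I) -> lie_ideal I.
Proof. by move=> h; split=> [|x y _]; [apply: subvf | apply: h]. Qed.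

Lemma ideal_lier I x y : lie_ideal I -> y \in I -> lie x y \in I.
Proof. by move=> [_ h]; apply: h; apply: memvf. Qed.

Lemma ideal_liel I x y : lie_ideal I -> x \in I -> lie x y \in I.
Proof. by move=> iI xI; rewrite lieC memvN ideal_lier. Qed.

(** By Engel's theorem such an ideal, if nonzero, has a nonzero center, which is
    an abelian ideal of [g]. *)
Lemma nilpotent_ideal0 I : lie_ideal I -> (forall x, x \in I -> ad_nilpotent x) -> I = 0%VS.
Proof.
move=> iI nI; apply/eqP; apply: contraT; rewrite -subv0 => I0.
have [w wI [w0 Iw]] : exists2 w, w \in I & w \notin 0%VS /\ forall x, x \in I -> lie x w \in 0%VS.
  apply: (engel _ nI) => //.
  - by move=> x y _; apply: ideal_lier.
  - by move=> x u _; rewrite !memv0 => /eqP ->; rewrite linear0.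
  by move=> x y _; apply: ideal_lier.
have [||Z ZP] := @vspace_of_pred _ _ (fun w => w \in I /\ forall x, x \in I -> lie x w = 0).
- by split=> [|x _]; rewrite ?mem0v ?linear0.
- move=> k u v [uI Iu] [vI Iv]; split=> [|x xI]; first by rewrite memvD ?memvZ.
  by rewrite lieDr lieZr Iu ?Iv // scaler0 addr0.
have Z0 : Z = 0%VS.
  apply: abelian_ideal0; last by move=> x y /ZP[xI _] /ZP[_ ->].
  apply: lie_idealP => x y /ZP[yI Iy]; apply/ZP; split; first exact: ideal_lier.
  by move=> z zI; rewrite lie_der !Iy ?linear0 ?addr0 // ideal_liel.
case/negP: w0; rewrite -Z0; apply/ZP; split=> // x xI.
by have := Iw _ xI; rewrite memv0 => /eqP.
Qed.

Lemma center_trivial x : (forall y, lie x y = 0) -> x = 0.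
Proof.
move=> x0; have [||Z ZP] := @vspace_of_pred _ _ (fun w => forall y, lie w y = 0).
- by move=> y; rewrite lie0l.
- by move=> k u v hu hv y; rewrite lieDl lieZl hu hv scaler0 addr0.
suff Z0 : Z = 0%VS by apply/eqP; rewrite -memv0 -Z0; apply/ZP.
apply: abelian_ideal0 => [|y z /ZP h _]; last exact: h.
by apply: lie_idealP => y z /ZP h; rewrite lieC h oppr0 mem0v.
Qed.

End Engel.

(** * Real part of a derivation *)

Section Derivations.
Variables (R : realType) (g : lieAlgType R).
Implicit Types (x y z v w : g) (d D : 'End(g)).

Definition derivation d := forall x y, d (lie x y) = lie (d x) y + lie x (d y).

Lemma ad_derivation x : derivation (ad x).
Proof. by move=> y z; rewrite !adE lie_der. Qed.

Lemma linear_form_ext u v : (forall phi : {linear g -> R^o}, phi u = phi v) -> u = v.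
Proof.
move=> h; apply/eqP; rewrite -subr_eq0 -memv0; apply: contraT => uv.
have [phi phi1 _] := separating_form uv.
by have /eqP := phi1; rewrite linearB h subrr eq_sym oner_eq0.
Qed.

Lemma imag_killed_app d a l v : imag_killed (fun u => d u - a *: u) l v ->
  imag_killed (fun u => d u - a *: u) l (d v - a *: v).
Proof.
elim: l v => /= [|b l IH] v; first by move=> ->; rewrite linear0 scaler0 subrr.
move=> /IH; pose S u := d u - a *: u.
rewrite -[_ - a *: _ in X in X -> _]/(S (S (S v) + b ^+ 2 *: v)).
rewrite -[X in _ -> imag_killed _ _ X]/(S (S (S v)) + b ^+ 2 *: S v).
suff -> : S (S (S v) + b ^+ 2 *: v) = S (S (S v)) + b ^+ 2 *: S v by [].
move: (S (S v)) => u; rewrite /S linearD linearZ /= !scalerDr scalerN !scalerA.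
by rewrite opprD addrACA [a * _]mulrC.
Qed.

Lemma formZ (phi : {linear g -> R^o}) a u : phi (a *: u) = a * phi u.
Proof. exact: linearZ. Qed.

(** Real parts of eigenvalues add up under the bracket. Write [S], [T] and [X]
    for [d] minus its expected real part on [v], [w] and [lie v w], so that
    [X = S + T] on brackets. If [S^2 = - b^2] and [T^2 = - e^2], then
    [(X^2 + b^2 + e^2)^2 = 4 b^2 e^2], that is
    [(X^2 + (b + e)^2) (X^2 + (b - e)^2) = 0]. In general [S^2 + b^2] and
    [T^2 + e^2] only shorten the lists that kill [v] and [w]; by induction, the
    equality holds modulo the eigenspace [Y] of [D], and [Y] absorbs the error. *)
Lemma imag_killed_lie d D a c l m v w : derivation d ->
  (forall h, (d \o h = h \o d)%VF -> (D \o h = h \o D)%VF) ->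
  (forall v a, D v = a *: v <-> exists l, imag_killed (fun u => d u - a *: u) l v) ->
  imag_killed (fun u => d u - a *: u) l v -> imag_killed (fun u => d u - c *: u) m w ->
  D (lie v w) = (a + c) *: lie v w.
Proof.
move=> dd cD kD; have Dd x : D (d x) = d (D x).
  by have /lfunP/(_ x) := cD d erefl; rewrite !comp_lfunE.
pose Y := lker (D - (a + c) *: \1)%VF.
have YP z : (z \in Y) = (D z == (a + c) *: z).
  by rewrite memv_ker add_lfunE opp_lfunE scale_lfunE id_lfunE subr_eq0.
pose S u := d u - a *: u; pose T u := d u - c *: u; pose X u := d u - (a + c) *: u.
have XY z : z \in Y -> X z \in Y.
  move=> zY; rewrite /X memvB ?memvZ // YP Dd; move: zY; rewrite YP => /eqP ->.
  by rewrite linearZ.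
have XL p q : X (lie p q) = lie (S p) q + lie p (T q).
  rewrite /X dd /S /T lieDl lieDr lieNl lieNr lieZl lieZr.
  by rewrite addrACA -opprD -scalerDl.
have XD k u z : X (k *: u + z) = k *: X u + X z.
  by rewrite /X linearP /= scalerBr !scalerDr !scalerA [_ * k]mulrC opprD addrACA.
have XN u : X (- u) = - X u by rewrite /X linearN scalerN opprB opprK addrC.
have XE u z : X (u + z) = X u + X z by rewrite -[u]scale1r XD !scale1r.
have XZ t u : X (t *: u) = t *: X u.
  by rewrite /X linearZ /= scalerBr !scalerA [t * _]mulrC.
have kX k z : imag_killed X k z -> z \in Y.
  by move=> h; rewrite YP; apply/eqP/kD; exists k.
have YX z : z \in Y -> exists k, imag_killed X k z.
  by rewrite YP => /eqP/kD.
clearbody X; have [n] := ubnP (size l + size m); elim: n l m v w => // n IH.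
move=> [|b l] [|e m] v w /=; rewrite ?ltnS.
- by move=> _ ->; rewrite lie0l linear0 scaler0.
- by move=> _ -> _; rewrite lie0l linear0 scaler0.
- by move=> _ _ ->; rewrite !linear0 ?scaler0.
move=> sz vl wm.
have HY p q : imag_killed (fun u => d u - a *: u) (b :: l) p ->
    imag_killed (fun u => d u - c *: u) (e :: m) q ->
  (lie (S (S p) + b ^+ 2 *: p) q \in Y) /\ (lie p (T (T q) + e ^+ 2 *: q) \in Y).
  move=> pl qm; rewrite !YP; split; apply/eqP.
    by apply: (IH l (e :: m)) => //=; lia.
  by apply: (IH (b :: l) m) => //=; lia.
have Q2 p q : imag_killed (fun u => d u - a *: u) (b :: l) p ->
    imag_killed (fun u => d u - c *: u) (e :: m) q ->
  X (X (lie p q)) + (b ^+ 2 + e ^+ 2) *: lie p q - 2 *: lie (S p) (T q) \in Y.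
  move=> pl qm; have [h1 h2] := HY _ _ pl qm.
  suff -> : X (X (lie p q)) + (b ^+ 2 + e ^+ 2) *: lie p q - 2 *: lie (S p) (T q)
    = lie (S (S p) + b ^+ 2 *: p) q + lie p (T (T q) + e ^+ 2 *: q) by apply: memvD.
  rewrite XL XE !XL (lieDl (S (S p)) (b ^+ 2 *: p)) lieZl.
  rewrite (lieDr p (T (T q)) (e ^+ 2 *: q)) lieZr.
  apply: linear_form_ext => phi.
  rewrite !(linearD phi, linearN phi, formZ phi).
  by ring.
have [_ h2] := HY _ _ vl wm.
have vl' : imag_killed (fun u => d u - a *: u) (b :: l) (S v) by exact: imag_killed_app.
have wm' : imag_killed (fun u => d u - c *: u) (e :: m) (T w) by exact: imag_killed_app.
pose z := lie v w; pose z' := lie (S v) (T w).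
have F1 := Q2 _ _ vl wm; rewrite -/z -/z' in F1.
(* here [S^2] and [T^2] are replaced by [- b^2] and [- e^2], modulo [Y] *)
have F2 : X (X z') + (b ^+ 2 + e ^+ 2) *: z' - (2 * b ^+ 2 * e ^+ 2) *: z \in Y.
  have F := Q2 _ _ vl' wm'; rewrite -/z' in F.
  have G1 : lie (S (S v) + b ^+ 2 *: v) (T (T w)) \in Y.
    rewrite YP; apply/eqP; apply: (IH l (e :: m)) => //=.
    exact: (imag_killed_app wm').
  have -> : X (X z') + (b ^+ 2 + e ^+ 2) *: z' - (2 * b ^+ 2 * e ^+ 2) *: z =
     (X (X z') + (b ^+ 2 + e ^+ 2) *: z' - 2 *: lie (S (S v)) (T (T w)))
     + 2 *: lie (S (S v) + b ^+ 2 *: v) (T (T w))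
     - (2 * b ^+ 2) *: lie v (T (T w) + e ^+ 2 *: w).
    rewrite (lieDl (S (S v)) (b ^+ 2 *: v)) lieZl.
    rewrite (lieDr v (T (T w)) (e ^+ 2 *: w)) lieZr -/z; apply: linear_form_ext => phi.
    by rewrite !(linearD phi, linearN phi, formZ phi); ring.
  by apply: memvB; [apply: memvD => //|]; apply: memvZ.
have [k hk] : exists k, imag_killed X k (X (X (X (X z) + (b + e) ^+ 2 *: z)) +
     (b - e) ^+ 2 *: (X (X z) + (b + e) ^+ 2 *: z)).
  apply: YX.
  have {}F1' := XY _ (XY _ F1).
  rewrite !(XE, XN, XZ) in F1' *.
  rewrite (_ : _ + _ = (X (X (X (X z))) + (b ^+ 2 + e ^+ 2) *: X (X z) - 2 *: X (X z'))
    + (b ^+ 2 + e ^+ 2) *: (X (X z) + (b ^+ 2 + e ^+ 2) *: z - 2 *: z')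
    + 2 *: (X (X z') + (b ^+ 2 + e ^+ 2) *: z' - (2 * b ^+ 2 * e ^+ 2) *: z)).
    by apply: memvD; [apply: memvD => //|]; apply: memvZ.
  apply: linear_form_ext => phi.
  by rewrite !(linearD phi, linearN phi, formZ phi); ring.
by apply/eqP; rewrite -YP; apply: (kX (b + e :: b - e :: k)).
Qed.

(** By [imag_killed_lie] the Leibniz rule holds on the eigenvectors of [D],
    which span [g]. *)
Lemma real_part_derivation d D : derivation d ->
  (forall h, (d \o h = h \o d)%VF -> (D \o h = h \o D)%VF) ->
  (forall v a, D v = a *: v <-> exists l, imag_killed (fun u => d u - a *: u) l v) ->
  diagonalizable_op D -> derivation D.
Proof.
move=> dd cD kD [bs bsP Db].
have sp : <<bs>>%VS = fullv by apply: span_basis.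
have h v w : v \in bs -> D (lie v w) = lie (D v) w + lie v (D w).
  move=> vb; suff /lfunP/(_ w) : (D \o ad v = ad (D v) + (ad v \o D))%VF.
    by rewrite add_lfunE !comp_lfunE !adE.
  apply/(fullv_lfunP _ _ sp) => {}w wb.
  rewrite add_lfunE !comp_lfunE !adE.
  have [a va] := Db _ vb; have [c wc] := Db _ wb.
  have [l hl] := (kD v a).1 va; have [m hm] := (kD w c).1 wc.
  by rewrite (imag_killed_lie dd cD kD hl hm) va wc lieZl lieZr scalerDl.
move=> x w; suff /lfunP/(_ x) : (D \o ad w = (ad w \o D) + ad (D w))%VF.
  rewrite add_lfunE !comp_lfunE !adE => E.
  by rewrite (lieC x w) linearN /= E opprD -!lieC.
apply/(fullv_lfunP _ _ sp) => v vb.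
rewrite add_lfunE !comp_lfunE !adE (lieC w v) linearN /= h // opprD.
by rewrite -!lieC.
Qed.

End Derivations.

(** * Cartan's criterion and hyperbolic parts *)

Section Semisimple.
Variables (R : realType) (g : lieAlgType R).
Hypothesis ss : semisimple g.
Implicit Types (x y z h e : g) (D : 'End(g)) (I J U : {vspace g}).

Lemma bracket_derivation D y : derivation D ->
  ((D \o ad y) - (ad y \o D))%VF = ad (D y).
Proof.
move=> dD; apply/lfunP => z; rewrite add_lfunE opp_lfunE !comp_lfunE !adE dD.
by rewrite addrK.
Qed.

Lemma op_tr_ad_derivation D x y : derivation D ->
  op_tr (ad (lie x y) \o D)%VF = - kappa x (D y).
Proof.
move=> dD; rewrite ad_lie op_tr_invariant -opprB bracket_derivation //.
by rewrite comp_lfunNr -scaleN1r op_trZ mulN1r.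
Qed.

(** Eigenvectors of [ad x] for a real eigenvalue are killed by the one-element
    list [[:: 0]], hence are eigenvectors of [D] too. *)
Lemma real_part_ad x : exists D : 'End(g),
 [/\ derivation D, diagonalizable_op D,
     forall v a, lie x v = a *: v -> D v = a *: v,
     op_tr (ad x \o D)%VF = op_tr (D \o D)%VF &
     D = 0 -> kappa x x <= 0 /\ (kappa x x = 0 -> ad_nilpotent x)].
Proof.
have [D [cD dD kD tD zD]] := real_part_op (ad x); exists D; split=> //.
- exact: (real_part_derivation (@ad_derivation _ _ x) cD kD dD).
- move=> v a xv; apply/kD; exists [:: 0] => /=.
  by rewrite !adE xv subrr linear0 expr0n scaler0 subrr scale0r addr0.
move/zD => [k1 k2]; split=> // /k2[k hk]; exists k => y; rewrite -[RHS](hk y).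
by elim: k {hk} => //= k ->; rewrite adE.
Qed.

(** Cartan's criterion. For [x] in the ideal [[rad, g]], where [rad] is the
    radical of the form, [ad x] has trace 0 against every derivation. Against
    its own real part this trace is a sum of squares, so all eigenvalues of
    [ad x] are imaginary, and then zero because [kappa x x = 0]. So [[rad, g]]
    is an ideal of nilpotent elements and vanishes: [rad] is central. *)
Lemma kappa_nondegenerate x : (forall y, kappa x y = 0) -> x = 0.
Proof.
pose rad z := forall y, kappa z y = 0.
have radl z y : rad z -> rad (lie z y) by move=> h t; rewrite kappa_lie.
(* [nil] is a linear condition, so it defines an ideal, which contains [[rad, g]] *)
pose nil z := rad z /\ forall D, derivation D -> op_tr (ad z \o D)%VF = 0.
have radnil z y : rad z -> nil (lie z y).
  by move=> rz; split=> [|D dD]; [exact: radl | rewrite op_tr_ad_derivation // rz oppr0].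
have [||N NP] := @vspace_of_pred _ _ nil.
- by split=> [y|D _]; rewrite ?kappa0l // linear0 comp_lfun0l -(scale0r 0) op_trZ mul0r.
- move=> k u v [ru tu] [rv tv]; split=> [y|D dD].
    by rewrite kappaDl kappaZl ru rv mulr0 addr0.
  by rewrite linearP /= comp_lfunDl op_trD -comp_lfunZl op_trZ tu ?tv // mulr0 addr0.
have N0 : N = 0%VS.
  apply: (nilpotent_ideal0 ss).
    apply: lie_idealP => z y /NP[ry _]; rewrite lieC memvN; apply/NP.
    exact: radnil.
  move=> z /NP[rz tz]; have [D [dD gD _ tD zD]] := real_part_ad z.
  have D0 : D = 0 by apply: diag_op_tr_eq0 => //; rewrite -tD tz.
  by have [_] := zD D0; apply; apply: rz.
move=> rx; apply: (center_trivial ss) => y.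
by apply/eqP; rewrite -memv0 -N0; apply/NP/radnil.
Qed.

Lemma ad_eq0 x : ad x = 0 -> x = 0.
Proof. by move=> x0; apply: (center_trivial ss) => y; rewrite -adE x0 zero_lfunE. Qed.

Lemma op_tr_linear D : linear ((fun y => op_tr (D \o ad y)%VF) : g -> R^o).
Proof.
by move=> a y z; rewrite linearP comp_lfunDr op_trD -comp_lfunZr op_trZ.
Qed.

(** Represent the form [y |-> tr (D o ad y)] by [x]. The derivation [D - ad x]
    has trace 0 against every [ad y], and nondegeneracy makes it vanish. *)
Lemma derivation_inner D : derivation D -> exists x, D = ad x.
Proof.
move=> dD.
pose lphi := GRing.isLinear.Build R g R^o _ _ (op_tr_linear D).
pose phi : {linear g -> R^o} := HB.pack (fun y => op_tr (D \o ad y)%VF : R^o) lphi.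
have [|x _ xP] := @kappa_riesz _ _ fullv phi.
  by move=> u _ h; apply: kappa_nondegenerate => y; apply/h/memvf.
exists x; pose F := D - ad x.
have F0 y : op_tr (F \o ad y)%VF = 0.
  rewrite /F comp_lfunDl comp_lfunNl op_trB -[op_tr (ad x \o _)%VF]/(kappa x y).
  by rewrite xP ?memvf // subrr.
have dF : derivation F.
  move=> y z; rewrite /F !add_lfunE !opp_lfunE dD ad_derivation lieDl lieDr.
  by rewrite lieNl lieNr opprD addrACA.
apply/eqP; rewrite -subr_eq0 -/F; apply/eqP/lfunP => y; rewrite zero_lfunE.
apply: kappa_nondegenerate => z.
by rewrite /kappa -(bracket_derivation _ dF) op_tr_invariant -ad_lie F0.
Qed.

(** The real part of [ad x] is a derivation, so it is the adjoint action of an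
    element of [g]. The second property says in particular that [h] commutes
    with all that commutes with [x]. *)
Lemma hyperbolic_part x : exists h,
 [/\ diagonalizable_op (ad h),
     forall v a, lie x v = a *: v -> lie h v = a *: v,
     kappa x h = kappa h h &
     h = 0 -> kappa x x <= 0].
Proof.
have [D [dD gD eD tD zD]] := real_part_ad x.
have [h hD] := derivation_inner dD; rewrite hD in gD eD tD zD.
exists h; split=> //; first by move=> v a /eD; rewrite adE.
by move=> h0; have [|//] := zD _; rewrite h0 linear0.
Qed.

Lemma kappa_diag_ge0 h : diagonalizable_op (ad h) -> 0 <= kappa h h.
Proof. exact: diag_op_tr_ge0. Qed.

Lemma kappa_diag_eq0 h : diagonalizable_op (ad h) -> kappa h h = 0 -> h = 0.
Proof. by move=> dh h0; apply/ad_eq0/diag_op_tr_eq0. Qed.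

End Semisimple.

(** * Cartan subspaces *)

Section Cartan.
Variables (R : realType) (g : lieAlgType R).
Implicit Types (x y z h e f H : g) (I J U V a : {vspace g}).

Lemma cartan_above U : lie_abelian U -> ad_diagonalizable U ->
  exists2 a, cartan_subspace a & (U <= a)%VS.
Proof.
move=> aU dU; pose P V := [/\ lie_abelian V, ad_diagonalizable V & (U <= V)%VS].
have [//|a [aa da Ua] maxa] := @ex_max_vspace _ _ P U.
exists a => //; split=> // V aV dV le_aV; apply/eqP.
by rewrite eq_sym eqEdim le_aV maxa //; split=> //; apply: subv_trans le_aV.
Qed.

Lemma ad_diagonalizableW U x : ad_diagonalizable U -> x \in U -> diagonalizable_op (ad x).
Proof.
by case=> b bP bU xU; exists b => // v vb; have [k] := bU _ _ xU vb; exists k; rewrite adE.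
Qed.

(** Commuting diagonalizable operators have a common basis of eigenvectors. *)
Lemma ad_diagonalizable_add_line U h : lie_abelian U -> ad_diagonalizable U ->
    diagonalizable_op (ad h) -> (forall x, x \in U -> lie h x = 0) ->
  lie_abelian (U + <[h]>)%VS /\ ad_diagonalizable (U + <[h]>)%VS.
Proof.
move=> aU dU dh hU; split.
  move=> _ _ /memv_addP[u uU [_ /vlineP[j ->] ->]] /memv_addP[v vU [_ /vlineP[k ->] ->]].
  by rewrite lieDl !lieDr !lieZl !lieZr lie_alt (lieC u h) !hU // aU // oppr0 !scaler0 !addr0.
pose fs := ad h :: [seq ad x | x <- vbasis U].
have com x y : lie x y = 0 -> (ad x \o ad y)%VF = (ad y \o ad x)%VF.
  by move=> xy; apply/eqP; rewrite -subr_eq0 -ad_lie xy linear0.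
have [||b bP bfs] := @codiagonalizable_op _ _ fs.
- move=> _ _ /predU1P[->|/mapP[x /vbasis_mem xU ->]] /predU1P[->|/mapP[y /vbasis_mem yU ->]] //;
    apply: com; [exact: hU | by rewrite lieC hU ?oppr0 | exact: aU].
- move=> _ /predU1P[->//|/mapP[x /vbasis_mem xU ->]].
  exact: ad_diagonalizableW xU.
exists b => // x v xUh vb.
have [||W WP] := @vspace_of_pred _ _ (fun x => exists k : R, lie x v = k *: v).
- by exists 0; rewrite lie0l scale0r.
- move=> k x1 x2 [c1 h1] [c2 h2]; exists (k * c1 + c2).
  by rewrite lieDl lieZl h1 h2 scalerDl scalerA.
apply/WP; apply: subvP xUh; rewrite subv_add; apply/andP; split.
  rewrite -(span_basis (vbasisP U)); apply/span_subvP => y yU; apply/WP.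
  have [|k] := bfs (ad y) _ _ vb; last by rewrite adE; exists k.
  by rewrite inE map_f ?orbT.
rewrite -memvE; apply/WP; have [|k] := bfs (ad h) _ _ vb; last by rewrite adE; exists k.
by rewrite inE eqxx.
Qed.

(** Maximality of [a]. *)
Lemma cartan_mem a h : cartan_subspace a -> diagonalizable_op (ad h) ->
  (forall x, x \in a -> lie h x = 0) -> h \in a.
Proof.
move=> [aa da maxa] dh ha; have [ab di] := ad_diagonalizable_add_line aa da dh ha.
by rewrite -(maxa _ ab di) ?addvSl // (subvP (addvSr a _)) ?memv_line.
Qed.

Hypothesis ss : semisimple g.

Lemma killingE I x y : lie_ideal I -> x \in I -> killing I x y = kappa x y.
Proof.
move=> iI xI; rewrite /kappa (@op_tr_sub _ _ _ I) => [|v].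
  by apply: eq_bigr => i _; rewrite comp_lfunE !adE.
by rewrite comp_lfunE adE ideal_liel.
Qed.

(** A minimal nonzero ideal [I] is then a compact factor: the orthogonal of [I]
    is a complementary ideal that commutes with [I], so that an ideal of [I] is
    an ideal of [g]. *)
Lemma negative_definite_compact_factor : (0 < \dim {:g})%N ->
  (forall x, x != 0 -> kappa x x < 0) -> ~ no_compact_factor g.
Proof.
move=> g0 neg ncf; have kap0 x : kappa x x = 0 -> x = 0.
  by move=> k0; apply: contraTeq isT => /neg; rewrite k0 ltxx.
pose P I := lie_ideal I /\ I != 0%VS.
have Pf : P fullv.
  split; last by rewrite -dimv_eq0 -lt0n.
  by apply: lie_idealP => x y _; apply: memvf.
have [I [iI I0] minI] := ex_min_vspace Pf.
apply: (ncf I iI); last by move=> x xI x0; rewrite killingE // neg.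
split=> [aI|J [JI iJ]]; first by move: I0; rewrite (abelian_ideal0 ss iI aI) eqxx.
have [->|J0] := eqVneq J 0%VS; [by left | right].
apply/eqP; rewrite eqEdim JI minI //; split=> //.
apply: lie_idealP => y w wJ; have wI := subvP JI _ wJ.
have [|u uI uP] := @kappa_riesz _ _ I (kappa y).
  by move=> u uI h; apply: kap0; apply: h.
have -> : y = u + (y - u) by rewrite addrC subrK.
suff -> : lie (u + (y - u)) w = lie u w by apply: iJ.
rewrite lieDl; suff -> : lie (y - u) w = 0 by rewrite addr0.
apply: kap0; rewrite kappa_lie kappaDl kappaNl uP ?subrr //.
by rewrite ideal_liel.
Qed.

(** If 0 is a Cartan subspace, no element has a hyperbolic part, hence the
    Killing form is nonpositive. Being nondegenerate, it is negative definite. *)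
Lemma cartan_neq0 a : (0 < \dim {:g})%N -> no_compact_factor g ->
  cartan_subspace a -> a != 0%VS.
Proof.
move=> g0 ncf ca; apply/negP => /eqP a0.
apply: negative_definite_compact_factor => // x x0.
have neg y : kappa y y <= 0.
  have [h [dh _ _ hP]] := hyperbolic_part ss y; apply: hP.
  apply/eqP; rewrite -memv0 -a0; apply: cartan_mem => // z.
  by rewrite a0 memv0 => /eqP ->; rewrite linear0.
rewrite lt_neqAle neg andbT; apply: contra_neq x0 => k0.
apply: (kappa_nondegenerate ss) => y; apply/eqP; apply: contraT => xy.
(* this [t] makes the form equal to 1 at [t *: x + y] *)
pose t := (1 - kappa y y) / (2 * kappa x y).
have := neg (t *: x + y).
rewrite !(kappaDl, kappaDr, kappaZl, kappaZr) k0 (kappaC y x) !mulr0 add0r.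
have -> : t * kappa x y + (t * kappa x y + kappa y y) = 1 by rewrite /t; field.
by rewrite ler10.
Qed.

End Cartan.

(** * Root vectors *)

Section Sl2.
Variables (R : realType) (g : lieAlgType R).
Implicit Types (x y z h e f H : g) (I J U V a : {vspace g}).
Hypothesis ss : semisimple g.

Definition weight_vector a (al : g -> R) e := forall H, H \in a -> lie H e = al H *: e.

Lemma kappa_weight a al be e f : weight_vector a al e -> weight_vector a be f ->
  (exists2 H, H \in a & al H + be H != 0) -> kappa e f = 0.
Proof.
move=> he hf [H Ha]; apply: contraNeq => ef.
have := kappa_lie H e f; rewrite -[kappa H _]opprK -kappaNl.
have : kappa (lie H e) f = - kappa e (lie H f).
  by rewrite lieC kappaNl kappa_lie.
rewrite he // hf // kappaZl kappaZr => /eqP; rewrite -addr_eq0 -mulrDl mulf_eq0.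
by rewrite (negPf ef) orbF.
Qed.

Lemma weight_lie a al be e f : weight_vector a al e -> weight_vector a be f ->
  weight_vector a (al \+ be) (lie e f).
Proof. by move=> he hf H Ha; rewrite lie_der (he H) // (hf H) // lieZl lieZr scalerDl. Qed.

Lemma weight_basis a : ad_diagonalizable a ->
  exists (X : (\dim {:g}).-tuple g) (be : 'I_(\dim {:g}) -> g -> R),
    basis_of {:g} X /\ forall i, weight_vector a (be i) X`_i.
Proof.
case=> b bP ba; have sb : size b == \dim {:g} by rewrite eq_sym (size_basis (X := in_tuple b)).
exists (Tuple sb).
have ex i : exists w : g -> R, weight_vector a w b`_i.
  suff /choice[w wP] : forall H, exists c : R, H \in a -> lie H b`_i = c *: b`_i.
    by exists w.
  move=> H.
  have [Ha|nHa] := boolP (H \in a); last by exists 0.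
  have [ib|ib] := ltnP i (size b); last by exists 0; rewrite nth_default // linear0 scaler0.
  by have [|c ?] := ba H b`_i Ha; [rewrite mem_nth | exists c].
have [be beP] := choice ex.
by exists (fun i => be i).
Qed.

(** The hyperbolic part of such an [x] lies in [a] by maximality and is
    orthogonal to itself, so it is 0: [ad x] has no nonzero real eigenvalue. *)
Lemma compact_part_eigenvalue a x v (c : R) : cartan_subspace a ->
  (forall H, H \in a -> lie H x = 0) -> (forall H, H \in a -> kappa x H = 0) ->
  lie x v = c *: v -> c *: v = 0.
Proof.
move=> ca xa kx xv; have [h [dh hx kh _]] := hyperbolic_part ss x.
have ha : h \in a.
  apply: cartan_mem => // y ya; rewrite -[RHS](scale0r y); apply: hx.
  by rewrite lieC xa // oppr0 scale0r.
have h0 : h = 0 by apply: (kappa_diag_eq0 ss) => //; rewrite -kh kx.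
by rewrite -(hx _ _ xv) h0 lie0l.
Qed.

(** Let [e] be a root vector and [m] the part of the centralizer of [a] that is
    orthogonal to [a]. Elements of [m] have no nonzero real eigenvalue, so [e]
    is not in [[m, e]], and nondegeneracy of the Killing form gives [f], of
    weight [- al], with [kappa f e = 1] and [f] orthogonal to [[m, e]]. Then
    [lie e f] commutes with [a] and is orthogonal to [m], so it is in [a]; it is
    the element of [a] that represents [al]. *)
Lemma root_vectors a : cartan_subspace a -> a != 0%VS ->
  exists al e f, [/\ weight_vector a al e, weight_vector a (\- al) f,
    lie e f \in a, 0 < al (lie e f) &
    forall H, H \in a -> al H = kappa (lie e f) H].
Proof.
move=> ca a0; have [aa da maxa] := ca.
have [X [be [bX wX]]] := weight_basis da.
pose H0 := vpick a; have H0a : H0 \in a by apply: memv_pick.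
have H00 : H0 != 0 by rewrite vpick0.
have [i0 be0] : exists i0, be i0 H0 != 0.
  apply/existsP; rewrite -negb_forall; apply: contraNN H00 => /forallP h.
  apply/eqP/(center_trivial ss) => y; rewrite (coord_basis bX (memvf y)) linear_sum big1 // => i _.
  by rewrite linearZ /= wX // (eqP (h i)) scale0r scaler0.
set al := be i0 in be0; pose e := X`_i0.
have we : weight_vector a al e by exact: wX.
have e0 : e != 0 by apply: (basis_not0 bX); rewrite mem_nth ?size_tuple.
pose m x := (forall H, H \in a -> lie H x = 0) /\ (forall H, H \in a -> kappa x H = 0).
have kappa_a u : u \in a -> (forall w, w \in a -> kappa u w = 0) -> u = 0.
  move=> ua h; apply: (kappa_diag_eq0 ss); last exact: h.
  exact: ad_diagonalizableW ua.
have split_a x : (forall H, H \in a -> lie H x = 0) -> exists2 u, u \in a & m (x - u).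
  move=> xa; have [u ua uP] := kappa_riesz (kappa x) kappa_a; exists u => //; split=> H Ha.
    by rewrite linearB /= xa // (aa H u) // subrr.
  by rewrite kappaDl kappaNl uP // subrr.
have [||L LP] := @vspace_of_pred _ _ (fun z => exists2 x, m x & z = lie x e).
- by exists 0; [split=> H _; rewrite ?linear0 ?kappa0l | rewrite lie0l].
- move=> k _ _ [x [x1 x2] ->] [y [y1 y2] ->]; exists (k *: x + y); last by rewrite lieDl lieZl.
  split=> H Ha; first by rewrite lieDr lieZr x1 ?y1 // scaler0 addr0.
  by rewrite kappaDl kappaZl x2 ?y2 // mulr0 addr0.
have eL : e \notin L.
  apply/negP => /LP[x [x1 x2]] E; case/negP: e0; apply/eqP.
  by rewrite -[e]scale1r; apply: (compact_part_eigenvalue ca x1 x2); rewrite scale1r -E.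
have [phi phie phiL] := separating_form eL.
have [|f0 _ f0P] := @kappa_riesz _ _ fullv phi.
  by move=> u _ h; apply: (kappa_nondegenerate ss) => y; apply/h/memvf.
(* [f] is the component of weight [- al] of the vector that represents [phi] *)
pose opp_al i := `[< forall H, H \in a -> be i H = - al H >].
pose f := \sum_(i | opp_al i) coord X i f0 *: X`_i.
have wf : weight_vector a (\- al) f.
  move=> H Ha; rewrite linear_sum scaler_sumr; apply: eq_bigr => i /asboolP h.
  by rewrite linearZ /= wX // h // !scalerA mulrC.
have kf z : weight_vector a al z -> kappa f z = phi z.
  move=> wz; rewrite -f0P ?memvf // [in RHS](coord_basis bX (memvf f0)).
  rewrite (bigID opp_al) /= -/f kappaDl [X in _ = _ + X]kappaC linear_sum big1 ?addr0 // => i.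
  move=> /asboolPn/existsNP[H /not_implyP[Ha /eqP bH]].
  rewrite linearZ /= kappaC (kappa_weight (wX i) wz) ?scaler0 //.
  by exists H; rewrite // addr_eq0.
have wh : weight_vector a (al \+ (\- al)) (lie e f) by exact: weight_lie.
have h_cent H : H \in a -> lie H (lie e f) = 0 by move=> Ha; rewrite wh //= subrr scale0r.
have [u ua mu] := split_a _ h_cent.
have ef_m y : m y -> kappa (lie e f) y = 0.
  move=> my; rewrite lieC kappaNl kappa_lie (lieC e y) linearN /= opprK kf.
    by apply: phiL; apply/LP; exists y.
  by move=> H Ha; rewrite lie_der (my.1 H) // (we H) // lie0l add0r lieZr.
(* [lie e f - u] is orthogonal to the other weight spaces, to [a] and to [m] *)
have h_eq_u : lie e f = u.
  apply/eqP; rewrite -subr_eq0; apply/eqP/(kappa_nondegenerate ss) => y.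
  rewrite (coord_basis bX (memvf y)) linear_sum big1 // => i _; rewrite linearZ /=.
  have [/existsNP[H /not_implyP[Ha /eqP bH]]|Xa] :=
    pselect (~ forall H, H \in a -> be i H = 0).
    rewrite kappaC (@kappa_weight a (be i) (fun=> 0) _ _ (wX i)) ?scaler0 //.
      by move=> H' H'a; rewrite mu.1 // scale0r.
    by exists H; rewrite // addr0.
  have [w wa mw] : exists2 w, w \in a & m (X`_i - w).
    by apply: split_a => H Ha; rewrite wX // (contrapT Xa) // scale0r.
  rewrite -[X`_i](subrK w) kappaDr (mu.2 w) // addr0 kappaDl kappaNl ef_m // kappaC.
  by rewrite mw.2 // subrr scaler0.
have ha : lie e f \in a by rewrite h_eq_u.
have kh H : H \in a -> al H = kappa (lie e f) H.
  move=> Ha; rewrite lieC kappaNl kappa_lie (lieC e H) linearN /= opprK we //.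
  by rewrite kappaZr kf // phie mulr1.
exists al, e, f; split=> //; rewrite kh // lt_neqAle eq_sym.
have dh : diagonalizable_op (ad (lie e f)) by exact: ad_diagonalizableW ha.
rewrite kappa_diag_ge0 // andbT; apply: contra_neq be0 => /(kappa_diag_eq0 ss dh) h0.
by rewrite kh // h0 kappa0l.
Qed.

End Sl2.

(** * Exponentials of nilpotent derivations *)

Section Exponential.
Variables (R : realType) (g : lieAlgType R).
Implicit Types (x y z h e f H : g) (U V a : {vspace g}) (d : 'End(g)).

Lemma iter_linear d k : linear (iter k d).
Proof. by move=> a x y; elim: k => //= k ->; rewrite linearP. Qed.

Lemma iter_zero d k : iter k d 0 = 0.
Proof. by elim: k => //= k ->; rewrite linear0. Qed.

(** Divided powers. *)
Definition dpow d k x : g := (k`!%:R)^-1 *: iter k d x.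

Lemma dpowS d k x : d (dpow d k x) = k.+1%:R *: dpow d k.+1 x.
Proof.
rewrite /dpow linearZ iterS scalerA factS natrM invfM mulrA.
by rewrite mulfV ?mul1r ?pnatr_eq0.
Qed.

Lemma dpow0 d x : dpow d 0 x = x. Proof. by rewrite /dpow fact0 invr1 scale1r. Qed.

(** The Leibniz rule for divided powers. *)
Lemma dpow_lie d k x y : derivation d ->
  dpow d k (lie x y) = \sum_(i < k.+1) lie (dpow d i x) (dpow d (k - i) y).
Proof.
move=> dd; elim: k => [|k IH]; first by rewrite big_ord1 !dpow0.
have k0 : k.+1%:R != 0 :> R by rewrite pnatr_eq0.
apply: (scalerI k0); rewrite -dpowS IH linear_sum /=.
transitivity (\sum_(i < k.+2) (i%:R + (k.+1 - i)%:R : R) *: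
    lie (dpow d i x) (dpow d (k.+1 - i) y)); last first.
  rewrite scaler_sumr; apply: eq_bigr => i _.
  by rewrite -natrD subnKC // -ltnS.
under [RHS]eq_bigr do rewrite scalerDl.
rewrite big_split /= [X in _ = X + _]big_ord_recl /= scale0r add0r.
rewrite [X in _ = _ + X]big_ord_recr /= subnn scale0r addr0 -big_split /=.
apply: eq_bigr => i _; rewrite dd !dpowS lieZl lieZr /bump /= add1n subSS.
by rewrite subSn // -ltnS.
Qed.

(** The exponential of [d], for [n] an exponent of nilpotency of [d]. *)
Definition dexp d n x : g := \sum_(i < n) dpow d i x.

Lemma dpow_eq0 d n k x : iter n d x = 0 -> (n <= k)%N -> dpow d k x = 0.
Proof.
by move=> dn /subnK <-; rewrite /dpow iterD dn iter_zero scaler0. Qed.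

Lemma dexp_stable d n k x : iter n d x = 0 -> (n <= k)%N -> dexp d k x = dexp d n x.
Proof.
move=> dn nk; rewrite /dexp -!(big_mkord xpredT (fun i => dpow d i x)).
rewrite (big_cat_nat (n := n)) //= [X in _ + X]big_nat_cond [X in _ + X]big1 ?addr0 // => i.
by rewrite andbT => /andP[ni _]; apply: dpow_eq0 ni.
Qed.

(** With both sums taken up to [n + n], the left-hand side is the sum over the
    triangle [i + j < n + n] and the right-hand side the sum over the square; the
    difference vanishes because [i] or [j] is at least [n] there. *)
Lemma dexp_lie d n x y : derivation d -> (forall z, iter n d z = 0) ->
  dexp d n (lie x y) = lie (dexp d n x) (dexp d n y).
Proof.
move=> dd dn; rewrite -[LHS](dexp_stable (k := n + n)) ?leq_addr //.
rewrite -(dexp_stable (k := n + n) (dn x)) ?leq_addr //.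
rewrite -(dexp_stable (k := n + n) (dn y)) ?leq_addr //.
set L := (n + n)%N; rewrite /dexp.
transitivity (\sum_(i < L) \sum_(j < L) lie (dpow d i x) (dpow d j y)); last first.
  rewrite lieC linear_sum /= -sumrN; apply: eq_bigr => i _.
  by rewrite (lieC _ (dpow d i x)) opprK linear_sum.
transitivity (\sum_(k < L) \sum_(i < L | (i <= k)%N) lie (dpow d i x) (dpow d (k - i) y)).
  apply: eq_bigr => k _; rewrite dpow_lie //.
  by rewrite (big_ord_widen _ (fun i => lie (dpow d i x) (dpow d (k - i) y)) (ltn_ord k)).
rewrite (exchange_big_dep predT) //=; apply: eq_bigr => i _.
rewrite -(big_mkord (fun k => (i <= k)%N) (fun k => lie (dpow d i x) (dpow d (k - i) y))).
rewrite -(big_mkord xpredT (fun j => lie (dpow d i x) (dpow d j y))).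
rewrite (big_cat_nat (n := i)) //=; last exact: ltnW.
rewrite [X in X + _]big_nat_cond big_pred0 ?add0r; last by move=> k; lia.
rewrite [RHS](big_cat_nat (n := L - i)) //=; last exact: leq_subr.
rewrite [X in _ = _ + X]big_nat_cond [X in _ = _ + X]big1 ?addr0; last first.
  move=> k; rewrite andbT => /andP[k1 k2].
  have [ni|ni] := leqP n i; first by rewrite (dpow_eq0 (dn x) ni) lie0l.
  by rewrite (dpow_eq0 (dn y)) ?linear0 //; lia.
rewrite -{1}[val i]add0n big_addn big_nat_cond [RHS]big_nat_cond.
apply: eq_big => [k|k _]; first by rewrite leq_addl !andbT.
by rewrite addnK.
Qed.

(** If [k] is the last exponent for which [iter k d x] is nonzero, then
    [iter k d (dexp d n x) = iter k d x]. *)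
Lemma dexp_inj d n x : (forall z, iter n d z = 0) -> dexp d n x = 0 -> x = 0.
Proof.
move=> dn x0; have exk : exists k, iter k d x == 0 by exists n; rewrite dn.
case: (ex_minnP exk) => -[|k] /eqP //= kx mink.
have [n0|n0] := posnP n; first by rewrite -(dn x) n0.
suff kx0 : iter k d x == 0 by have := mink _ kx0; rewrite ltnn.
have itE u v : iter k d (u + v) = iter k d u + iter k d v.
  by have := iter_linear d k 1 u v; rewrite !scale1r.
have it0 i : iter k d (dpow d i.+1 x) = 0.
  have := iter_linear d k (i.+1`!%:R)^-1 (iter i.+1 d x) 0.
  rewrite iter_zero !addr0 => ->.
  by rewrite -iterD addnS -addSn addnC iterD /= kx iter_zero scaler0.
have : iter k d (dexp d n x) = 0 by rewrite x0 iter_zero.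
rewrite /dexp -(prednK n0) big_ord_recl dpow0 itE => <-.
rewrite -[X in X == _]addr0; apply/eqP; congr (_ + _).
elim/big_ind: _ => [|u v hu hv|i _]; first by rewrite iter_zero.
  by rewrite itE -hu -hv addr0.
by rewrite lift0 it0.
Qed.

End Exponential.

(** * Conjugation inside an sl2-triple *)

Section Curve.
Variables (R : realType) (g : lieAlgType R).
Implicit Types (x y z h e f H : g) (U V a : {vspace g}) (d phi : 'End(g)).

(** [ad e] raises the eigenvalues of [ad h] by [c], and these are bounded. *)
Lemma weight_nilpotent h e (c : R) : diagonalizable_op (ad h) ->
  lie h e = c *: e -> c != 0 -> exists n, forall y, iter n (ad e) y = 0.
Proof.
case=> b bP bh he c0.
have sb : size b == \dim {:g} by rewrite eq_sym (size_basis (X := in_tuple b)).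
pose X := Tuple sb; have XP : basis_of {:g} X by [].
have [k kP] : exists k : 'I_(\dim {:g}) -> R, forall i : 'I_(\dim {:g}), lie h X`_i = k i *: X`_i.
  apply: (@fin_all_exists _ (fun=> R) (fun (i : 'I_(\dim {:g})) c => lie h X`_i = c *: X`_i)) => i.
  by have [|r] := bh X`_i; [rewrite mem_nth ?(eqP sb) | rewrite adE; exists r].
pose B := \sum_i `|k i|.
have kB i : `|k i| <= B by rewrite /B (bigD1 i) //= lerDl sumr_ge0.
(* an eigenvalue of [ad h] is one of the [k i] *)
have eigB u r : lie h u = r *: u -> B < `|r| -> u = 0.
  move=> hu Br; rewrite (coord_basis XP (memvf u)) big1 // => i _.
  have : coord X i (lie h u) = coord X i (r *: u) by rewrite hu.
  rewrite {1}(coord_basis XP (memvf u)) !linear_sum /=.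
  under eq_bigr do rewrite !linearZ /= kP linearZ /= coord_free ?(basis_free XP) //.
  rewrite (bigD1 i) //= eqxx mulr1 big1 ?addr0; last first.
    by move=> j /negPf ji; rewrite ji !mulr0.
  rewrite linearZ /= mulrC => /eqP; rewrite -subr_eq0 -mulrBl mulf_eq0 subr_eq0.
  case/orP => [/eqP kr|/eqP ->]; last by rewrite scale0r.
  by move: Br; rewrite -kr ltNge kB.
pose n := Num.bound (2 * B / `|c|).
have nP : 2 * B < n%:R * `|c|.
  rewrite -ltr_pdivrMr ?normr_gt0 //; apply: archi_boundP.
  by rewrite divr_ge0 // mulr_ge0 // /B sumr_ge0.
exists n => y; rewrite (coord_basis XP (memvf y)).
elim/big_ind: _ => [|u v hu hv|i _]; first exact: iter_zero.
  by have := iter_linear (ad e) n 1 u v; rewrite !scale1r hu hv addr0.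
have := iter_linear (ad e) n (coord X i y) X`_i 0.
rewrite iter_zero !addr0 => ->.
suff -> : iter n (ad e) X`_i = 0 by rewrite scaler0.
apply: (eigB _ (k i + n%:R * c)).
  elim: {nP}n => [|j IH]; first by rewrite mul0r addr0 kP.
  rewrite iterS adE lie_der he IH lieZl linearZ /= -scalerDl -natr1.
  by congr (_ *: _); ring.
have := ler_normB (k i + n%:R * c) (k i); rewrite addrAC subrr add0r normrM normr_nat.
have := kB i; lra.
Qed.

Definition automorphism phi :=
  injective phi /\ forall x y, phi (lie x y) = lie (phi x) (phi y).

Lemma exp_automorphism e n : (forall y, iter n (ad e) y = 0) ->
  exists2 phi, automorphism phi & forall y, phi y = dexp (ad e) n y.
Proof.
move=> en; have lin : linear (dexp (ad e) n).
  move=> k x y; rewrite scaler_sumr -big_split; apply: eq_bigr => i _ /=.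
  by rewrite /dpow iter_linear scalerDr !scalerA mulrC.
pose ldexp := GRing.isLinear.Build R g g _ _ lin.
pose F : {linear g -> g} := HB.pack (dexp (ad e) n) ldexp.
have FE y : linfun F y = dexp (ad e) n y by rewrite lfunE.
exists (linfun F) => //; split=> [x y|x y].
  rewrite !FE => /eqP; rewrite -subr_eq0 -(linearB F) => /eqP h.
  by apply/eqP; rewrite -subr_eq0; apply/eqP/(dexp_inj en h).
by rewrite !FE; apply: dexp_lie => //; apply: ad_derivation.
Qed.

Lemma dexp_quadratic d n x : (forall y, iter n d y = 0) -> d (d (d x)) = 0 ->
  dexp d n x = x + d x + 2^-1 *: d (d x).
Proof.
move=> dn d3; rewrite -(dexp_stable (k := n + 3) (dn x)) ?leq_addr //.
rewrite (dexp_stable (n := 3)) ?leq_addl // /dexp !big_ord_recr big_ord0 /= add0r.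
by rewrite /dpow /= !invr1 !scale1r.
Qed.

Lemma cartan_preimage phi U a : automorphism phi -> cartan_subspace a ->
  (forall x, x \in U -> phi x \in a) -> lie_abelian U /\ ad_diagonalizable U.
Proof.
move=> [phi_inj phi_lie] [aa [b bP ba] _] Ua; split=> [x y xU yU|].
  by apply: phi_inj; rewrite phi_lie linear0; apply: aa; apply: Ua.
have kphi : lker phi == 0%VS by apply/lker0P.
have phiV := lker0_lfunVK kphi.
exists [seq (phi^-1)%VF v | v <- b].
  rewrite basisEdim size_map; have := bP; rewrite basisEdim => /andP[sb ->]; rewrite andbT.
  rewrite -limg_span (span_basis bP); apply/subvP => x _.
  by rewrite -[x](lker0_lfunK kphi) memv_img ?memvf.
move=> x _ xU /mapP[v vb ->]; have [k xv] := ba _ _ (Ua _ xU) vb.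
by exists k; apply: phi_inj; rewrite phi_lie linearZ /= phiV.
Qed.

(** With [u = sqrt t] and [s = - 1 / (2 u)], the automorphism
    [exp (s ad e) o exp (u ad f)] maps [e + t f] first to [e - u h], then to
    [- u h], and it fixes the vectors that commute with [e] and [f]. So it maps
    the given space into [a]. *)
Lemma sl2_conjugate e f h a a' (t : R) : cartan_subspace a -> h \in a -> (a' <= a)%VS ->
    lie e f = h -> lie h e = 2 *: e -> lie h f = (- 2) *: f ->
    (forall H, H \in a' -> lie H e = 0 /\ lie H f = 0) -> 0 < t ->
  lie_abelian (a' + <[e + t *: f]>)%VS /\ ad_diagonalizable (a' + <[e + t *: f]>)%VS.
Proof.
move=> ca ha a'a ef he hf a'ef t0; have [_ da _] := ca.
have dh := ad_diagonalizableW da ha.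
pose u := Num.sqrt t; have u0 : u != 0 by rewrite gt_eqF // sqrtr_gt0.
have uu : u * u = t by rewrite -expr2 sqr_sqrtr // ltW.
pose s := - (2 * u)^-1.
have huf : lie h (u *: f) = (- 2) *: (u *: f) by rewrite lieZr hf !scalerA mulrC.
have hse : lie h (s *: e) = 2 *: (s *: e) by rewrite lieZr he !scalerA mulrC.
have [|n1 n1P] := weight_nilpotent dh huf; first by rewrite oppr_eq0 pnatr_eq0.
have [|n2 n2P] := weight_nilpotent dh hse; first by rewrite pnatr_eq0.
have [p1 p1a p1E] := exp_automorphism n1P.
have [p2 p2a p2E] := exp_automorphism n2P.
have pa : automorphism (p2 \o p1)%VF.
  split=> [x y|x y]; first by rewrite !comp_lfunE => /p2a.1/p1a.1.
  by rewrite !comp_lfunE p1a.2 p2a.2.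
apply: (cartan_preimage pa ca) => _ /memv_addP[H Ha [_ /vlineP[k ->] ->]].
have fe : lie f e = - h by rewrite lieC ef.
have fh : lie f h = 2 *: f by rewrite lieC hf scaleNr opprK.
have eh : lie e h = (- 2) *: e by rewrite lieC he scaleNr.
have p1e : p1 e = e - u *: h - t *: f.
  have d1e : ad (u *: f) e = - (u *: h) by rewrite adE lieZl fe scalerN.
  have d2e : ad (u *: f) (- (u *: h)) = - (2 * t) *: f.
    by rewrite adE linearN /= lieZl lieZr fh !scalerA scaleNr -uu; congr (- (_ *: _)); ring.
  have d3e : ad (u *: f) (- (2 * t) *: f) = 0.
    by rewrite adE lieZr lieZl lie_alt !scaler0.
  rewrite p1E dexp_quadratic // !d1e !d2e ?d3e // scalerA mulrN mulrA mulVf ?pnatr_eq0 //.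
  by rewrite mul1r scaleNr.
have p1f : p1 f = f.
  have d1 : ad (u *: f) f = 0 by rewrite adE lieZl lie_alt scaler0.
  by rewrite p1E dexp_quadratic // !d1 !linear0 ?scaler0 ?addr0.
have p2e : p2 e = e.
  have d1 : ad (s *: e) e = 0 by rewrite adE lieZl lie_alt scaler0.
  by rewrite p2E dexp_quadratic // !d1 !linear0 ?scaler0 ?addr0.
have p2h : p2 h = h - (2 * s) *: e.
  have d1 : ad (s *: e) h = - (2 * s) *: e.
    by rewrite adE lieZl eh scalerA mulrN mulrC.
  have d2 : ad (s *: e) (- (2 * s) *: e) = 0 by rewrite adE lieZr lieZl lie_alt !scaler0.
  by rewrite p2E dexp_quadratic // !d1 !d2 ?linear0 ?scaler0 // addr0 scaleNr.
have fix_p x p n : (forall y, p y = dexp (ad x) n y) -> (forall y, iter n (ad x) y = 0) ->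
    lie H x = 0 -> p H = H.
  move=> pE xn Hx; have d1 : ad x H = 0 by rewrite adE lieC Hx oppr0.
  by rewrite pE dexp_quadratic // !d1 !linear0 ?scaler0 ?addr0.
have [He Hf] := a'ef _ Ha.
have p21 : p2 (p1 (e + t *: f)) = - (u *: h).
  rewrite linearD linearZ /= p1e p1f addrNK linearB linearZ /= p2e p2h.
  rewrite scalerBr scalerA opprB addrA -{1}[e]scale1r -scalerDl.
  have -> : 1 + u * (2 * s) = 0 by rewrite /s; field.
  by rewrite scale0r add0r.
rewrite comp_lfunE addrC linearP /=  (fix_p _ _ _ p1E n1P) ?lieZr ?Hf ?scaler0 //.
rewrite linearP /= p21.
rewrite (fix_p _ _ _ p2E n2P) ?lieZr ?He ?scaler0 //.
by rewrite memvD ?memvZ ?memvN ?memvZ // (subvP a'a).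
Qed.

End Curve.

(** * Closed subsets of the Grassmannian *)

Section Grass.
Variables (R : realType) (V : vectType R).
Local Notation N := (\dim {:V}).
Local Notation E := (vbasis {:V}).

Lemma poly_eq0_pos (q : {poly R}) : (forall t, 0 < t -> q.[t] = 0) -> q = 0.
Proof.
move=> h; apply: (@roots_geq_poly_eq0 _ q [seq i.+1%:R | i <- iota 0 (size q)]).
- by apply/allP => _ /mapP[i _ ->]; apply/eqP/h; rewrite ltr0Sn.
- by rewrite map_inj_uniq ?iota_uniq // => i j /eqP; rewrite eqr_nat => /eqP[].
- by rewrite size_map size_iota.
Qed.

Lemma meval_homogeneous n (p : mpoly.mpoly n R) c (v : 'I_n -> R) :
  mpoly_homogeneous p -> exists d,
  mpoly.meval (fun k => c * v k) p = c ^+ d * mpoly.meval v p.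
Proof.
case=> d hd; exists d; rewrite !mpoly.mevalE big_distrr /=.
apply: eq_bigr => m _; have [->|/hd <-] := eqVneq (mpoly.mcoeff m p) 0.
  by rewrite !mul0r mulr0.
under eq_bigr do rewrite exprMn; rewrite big_split /= mulrCA; congr (_ * (_ * _)).
by rewrite prodrXr mpoly.mdegE.
Qed.

Definition poly_meval n (p : mpoly.mpoly n R) (P : 'I_n -> {poly R}) : {poly R} :=
  \sum_(m <- mpoly.msupp p)
    (mpoly.mcoeff m p)%:P * \prod_i P i ^+ mpoly.fun_of_multinom m i.

Lemma horner_poly_meval n (p : mpoly.mpoly n R) P t :
  (poly_meval p P).[t] = mpoly.meval (fun k => (P k).[t]) p.
Proof.
rewrite mpoly.mevalE horner_sum; apply: eq_bigr => m _.
rewrite hornerM hornerC horner_prod; congr (_ * _).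
by apply: eq_bigr => i _; rewrite horner_exp.
Qed.

Variable (r : nat).

(** The Pluecker coordinates of [U] are computed on [vbasis U]; the factor is the
    determinant of the change of basis to [v]. *)
Lemma pluecker_frame (U : grassmannian V r) (v : r.-tuple V) : gr_space U = <<v>>%VS ->
  exists2 c, c != 0 & forall J : {ffun 'I_r -> 'I_N}, pluecker U J =
    c * \det (\matrix_(i < r, j < r) coord E (J j) v`_i).
Proof.
move=> UE; pose X := vbasis U.
have sX : size X == r by rewrite size_tuple gr_dim.
have fX : free (Tuple sX) by exact: basis_free (vbasisP U).
pose C : 'M[R]_r := \matrix_(i, k) coord v k X`_i.
have XC (i : 'I_r) : X`_i = \sum_k C i k *: v`_k.
  have Xi : X`_i \in <<v>>%VS by rewrite -UE vbasis_mem // mem_nth // (eqP sX).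
  by rewrite {1}(coord_span Xi); apply: eq_bigr => k _; rewrite mxE.
exists (\det C).
  rewrite -unitfE -unitmxE -row_free_unit; apply/inj_row_free => b bC.
  apply/rowP => i; rewrite mxE; have /freeP h := fX.
  apply: (h (fun i => b 0 i)) => {i} /=.
  transitivity (\sum_k (b *m C) 0 k *: v`_k).
    under eq_bigr do rewrite XC scaler_sumr.
    rewrite exchange_big; apply: eq_bigr => k _; rewrite mxE scaler_suml.
    by apply: eq_bigr => i _; rewrite scalerA.
  by rewrite bC big1 // => k _; rewrite mxE scale0r.
move=> J; rewrite -det_mulmx; congr (\det _); apply/matrixP => i j.
rewrite !mxE XC linear_sum; apply: eq_bigr => k _.
by rewrite linearZ !mxE.
Qed.

(** Up to nonzero factors, the Pluecker coordinates of [U t] are polynomials in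
    [t]. A homogeneous equation of [Z], evaluated on them, gives a polynomial in
    [t] that vanishes for [t > 0], hence for all [t]. *)
Lemma zariski_closed_line (Z : set (grassmannian V r)) (u w : 'I_r -> V)
    (U : R -> grassmannian V r) : zariski_closed Z ->
    (forall t, gr_space (U t) = <<[seq (u i + t *: w i)%R | i <- enum 'I_r]>>%VS) ->
    (forall t, 0 < t -> Z (U t)) ->
  forall t, Z (U t).
Proof.
case=> F homF -> UE ZU t p Fp; have hp := homF _ Fp.
pose M (J : {ffun 'I_r -> 'I_N}) : 'M[{poly R}]_r :=
  \matrix_(i, j) ((coord E (J j) (u i))%:P + (coord E (J j) (w i))%:P * 'X).
pose P (k : 'I_#|{ffun 'I_r -> 'I_N}|) := \det (M (enum_val k)).
have plU s : exists2 c, c != 0 &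
    forall k, pluecker (U s) (enum_val k) = c * (P k).[s].
  have [|c c0 cP] := @pluecker_frame (U s) [tuple (u i + s *: w i)%R | i < r].
    exact: UE.
  exists c => // k; rewrite cP; congr (_ * _).
  rewrite -[RHS]/(horner_eval s _) -det_map_mx; congr (\det _).
  apply/matrixP => i j; rewrite !mxE -tnth_nth tnth_mktuple linearD linearZ /=.
  by rewrite /horner_eval !hornerE mulrC.
have evU s : exists2 c, c != 0 &
    mpoly.meval (fun k => pluecker (U s) (enum_val k)) p = c * (poly_meval p P).[s].
  have [c c0 cP] := plU s; have [d dP] := meval_homogeneous c (fun k => (P k).[s]) hp.
  exists (c ^+ d); first by rewrite expf_neq0.
  by rewrite horner_poly_meval -dP; congr mpoly.meval; apply/funext => k; apply: cP.
have P0 : poly_meval p P = 0.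
  apply: poly_eq0_pos => s s0; have [c c0 cP] := evU s.
  have /eqP := ZU s s0 p Fp; rewrite cP mulf_eq0 (negPf c0) => /eqP //.
by have [c _ ->] := evU t; rewrite P0 horner0 mulr0.
Qed.

End Grass.

Section Kappa.
Variables (R : realType) (g : lieAlgType R) (r : nat).
Local Notation N := (\dim {:g}).
Local Notation E := (vbasis {:g}).

Lemma open_kappa_neg (c : 'rV[R]_r) :
  open [set M : 'M[R]_(r, N) |
    kappa (\sum_j (c *m M) 0 j *: E`_j) (\sum_j (c *m M) 0 j *: E`_j) < 0].
Proof.
pose q (M : 'M[R]_(r, N)) := \sum_j \sum_k (c *m M) 0 j * (c *m M) 0 k * kappa E`_j E`_k.
have qE M : kappa (\sum_j (c *m M) 0 j *: E`_j) (\sum_j (c *m M) 0 j *: E`_j) = q M.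
  transitivity (\sum_k \sum_j (c *m M) 0 j * (c *m M) 0 k * kappa E`_j E`_k); last exact: exchange_big.
  rewrite linear_sum; apply: eq_bigr => k _ /=.
  rewrite kappaZr kappaC linear_sum /= big_distrr; apply: eq_bigr => j _ /=.
  by rewrite kappaZr kappaC !mulrA [X in X * _]mulrC.
have csum (I : Type) (s : seq I) (f : I -> 'M[R]_(r, N) -> R) :
    (forall i, continuous (f i)) -> continuous (fun M => \sum_(i <- s) f i M).
  by move=> cf; apply: continuous_big => //; exact: add_continuous.
have cc j : continuous (fun M : 'M[R]_(r, N) => (c *m M) 0 j).
  under eq_fun do rewrite mxE.
  apply: csum => i M; apply: (@continuousM _ _ (fun=> c 0 i) (fun M : 'M[R]_(r, N) => M i j)).
    exact: cst_continuous.
  exact: coord_continuous.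
have cq : continuous q.
  apply: (csum) => j; apply: (csum) => k M.
  apply: (@continuousM _ _ (fun M : 'M[R]_(r, N) => (c *m M) 0 j * (c *m M) 0 k)
    (fun=> kappa E`_j E`_k)).
    exact: (continuousM (cc j M) (cc k M)).
  exact: cst_continuous.
rewrite (_ : mkset _ = q @^-1` [set x | x < 0]); last by apply/seteqP; split=> M /=; rewrite qE.
by apply: open_comp => [M _|]; [exact: cq | exact: open_lt].
Qed.

(** The subspaces that contain a vector on which the Killing form is negative
    make up an open set. *)
Lemma negative_not_in_closure (Z : set (grassmannian g r)) (U : grassmannian g r) x :
    (forall W : grassmannian g r, Z W -> forall y, y \in gr_space W -> 0 <= kappa y y) ->
    x \in gr_space U -> kappa x x < 0 ->
  ~ closure Z U.
Proof.
move=> Zpos xU x0 clU.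
pose O := [set W : grassmannian g r | exists2 y, y \in gr_space W & kappa y y < 0].
have oO : open O.
  exists (\bigcup_(c in [set: 'rV[R]_r]) [set M : 'M[R]_(r, N) |
    kappa (\sum_j (c *m M) 0 j *: E`_j) (\sum_j (c *m M) 0 j *: E`_j) < 0]).
    by apply: bigcup_open => c _; apply: open_kappa_neg.
  move=> M W MW.
  pose v := [tuple \sum_(j < N) M i j *: E`_j | i < r].
  have vW : <<v>>%VS = gr_space W by rewrite -MW.
  have vE (c : 'rV_r) : \sum_j (c *m M) 0 j *: E`_j = \sum_i c 0 i *: v`_i.
    under [RHS]eq_bigr do rewrite -tnth_nth tnth_mktuple scaler_sumr.
    rewrite exchange_big; apply: eq_bigr => j _; rewrite mxE scaler_suml.
    by apply: eq_bigr => i _; rewrite scalerA.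
  split=> [[c _ /= h]|[y yW y0]].
    exists (\sum_j (c *m M) 0 j *: E`_j) => //; rewrite vE -vW.
    by apply: memv_suml => i _; rewrite memvZ // memv_span // mem_nth // size_tuple.
  rewrite -vW in yW; exists (\row_i coord v i y) => //=.
  suff -> : \sum_j ((\row_i coord v i y) *m M) 0 j *: E`_j = y by [].
  by rewrite vE {2}(coord_span yW); apply: eq_bigr => i _; rewrite mxE.
have [W [ZW [y yW]]] := clU O (open_nbhs_nbhs (conj oO (ex_intro2 _ _ x xU x0))).
by rewrite ltNge (Zpos W ZW).
Qed.

End Kappa.

(** * A line of subspaces through a Cartan subspace *)

Section Main.
Variables (R : realType) (g : lieAlgType R).
Implicit Types (x y z h e f H : g) (U V a : {vspace g}).
Hypothesis ss : semisimple g.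

(** The sl2-triple [(e, lie e f, f)] is obtained from [root_vectors] by scaling
    [f]; [b] is the kernel of the root in [a]. *)
Lemma root_sl2 a : cartan_subspace a -> a != 0%VS -> exists (b : {vspace g}) (e f : g),
  [/\ (b <= a)%VS /\ a = (b + <[lie e f]>)%VS, lie e f \in a,
    lie (lie e f) e = 2 *: e /\ lie (lie e f) f = (- 2) *: f,
    forall H, H \in b -> lie H e = 0 /\ lie H f = 0 & e != 0].
Proof.
move=> ca a0; have [al [e [f [we wf ha hpos alE]]]] := root_vectors ss ca a0.
set h := lie e f in ha hpos alE; set c := al h in hpos.
have c0 : c != 0 by rewrite gt_eqF.
have [||b bP] := @vspace_of_pred _ _ (fun H => H \in a /\ al H = 0).
- by split; rewrite ?mem0v // alE ?mem0v // linear0.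
- move=> k u v [ua u0] [va v0]; have kuv : k *: u + v \in a by rewrite memvD ?memvZ.
  by split=> //; rewrite alE // kappaDr kappaZr -!alE // u0 v0 mulr0 addr0.
have hE : lie e ((2 / c) *: f) = (2 / c) *: h by rewrite lieZr.
exists b, e, ((2 / c) *: f); rewrite hE.
have ba : (b <= a)%VS by apply/subvP => H /bP[].
have hca : (2 / c) *: h \in a by rewrite memvZ.
split=> //.
- split=> //; apply/eqP; rewrite eqEsubv subv_add ba -memvE hca !andbT.
  apply/subvP => H Ha; rewrite -[H](subrK ((al H / c) *: h)); apply: memv_add; last first.
    apply/vlineP; exists (al H / 2); rewrite scalerA; congr (_ *: _).
    by field; rewrite c0.
  have Hin : H - (al H / c) *: h \in a by rewrite memvB ?memvZ.
  apply/bP; split=> //; rewrite alE // -scaleNr kappaDr kappaZr -!alE // -/c.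
  by field.
- split; first by rewrite lieZl we // scalerA divfK.
  rewrite lieZl lieZr wf // !scalerA; congr (_ *: _) => /=; rewrite -/c.
  by field.
- move=> H /bP[Ha H0]; rewrite lieZr we // wf //= H0 oppr0 scale0r.
  by rewrite scale0r scaler0.
apply: contraTneq hpos => e0.
by rewrite /c alE // /h e0 lie0l kappa0l ltxx.
Qed.

(** Invariance gives [kappa h h = 2 * kappa e f], for [h = lie e f], while [e]
    and [f] are isotropic. So the value is [- kappa h h], and the Killing form is
    positive on [a]. *)
Lemma kappa_sl2 a e f : cartan_subspace a -> lie e f \in a -> e != 0 ->
  lie (lie e f) e = 2 *: e -> lie (lie e f) f = (- 2) *: f ->
  kappa (e - f) (e - f) < 0.
Proof.
move=> ca; set h := lie e f => ha e0 he hf; have [_ da _] := ca.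
have dh := ad_diagonalizableW da ha.
have hh : kappa h h = 2 * kappa e f.
  rewrite {1}/h kappa_lie (lieC f h) hf scaleNr opprK kappaZr.
  by [].
have pos : 0 < kappa h h.
  rewrite lt_neqAle eq_sym kappa_diag_ge0 // andbT; apply: contra_neq e0 => k0.
  have h0 := kappa_diag_eq0 ss dh k0; move/eqP: he; rewrite h0 lie0l eq_sym.
  by rewrite scaler_eq0 pnatr_eq0 /= => /eqP.
have ee : kappa e e = 0.
  have := kappa_lie h e e; have := kappa_lie e h e.
  rewrite (lieC e h) he kappaNl !kappaZl kappaZr => E _; lra.
have ff : kappa f f = 0.
  have := kappa_lie f h f.
  rewrite (lieC f h) hf kappaNl !kappaZl kappaZr => E; lra.
rewrite kappaDl !kappaNl !kappaDr !(kappaC _ (- f)) !kappaNl ee ff (kappaC f e).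
lra.
Qed.

End Main.

Theorem proposition3p2 (R : realType) (n r : nat) (G : lieGroupType R n)
    (g : lieAlgType R) :
  is_lie_algebra_of G g ->
  semisimple g ->
  (0 < \dim (fullv : {vspace g}))%N ->
  finitely_many_components G ->
  finite_center G ->
  no_compact_factor g ->
  is_real_rank g r ->
  ~ zariski_closed (closure (Cartan g r)).
Proof.
move=> _ ss g0 _ _ ncf rk clZ.
have [||a ca _] := @cartan_above _ g 0%VS.
- by move=> x y; rewrite !memv0 => /eqP -> _; rewrite lie0l.
- exists (vbasis fullv); first exact: vbasisP.
  by move=> x v; rewrite memv0 => /eqP -> _; exists 0; rewrite lie0l scale0r.
have a0 := cartan_neq0 ss g0 ncf ca.
have [b [e [f [[ba aE] ha [he hf] bef e0]]]] := root_sl2 ss ca a0.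
set h := lie e f in aE ha he hf.
have h0 : h != 0.
  apply: contra_neq e0 => h0; move/eqP: he; rewrite h0 lie0l eq_sym.
  by rewrite scaler_eq0 pnatr_eq0 /= => /eqP.
have hb : h \notin b.
  apply/negP => /bef[]; rewrite he => /eqP; rewrite scaler_eq0 pnatr_eq0 /=.
  by rewrite (negPf e0).
have rE : r = (\dim b).+1 by rewrite -(rk _ ca) aE dim_add_line.
subst r; set r := \dim b in rk clZ *.
have xb t : e + t *: f \notin b.
  apply/negP => /bef[_]; rewrite lieDl lieZl lie_alt scaler0 addr0.
  by move/eqP; rewrite (negPf h0).
have dU t : \dim (b + <[e + t *: f]>)%VS == r.+1 by rewrite dim_add_line.
pose U t : grassmannian g r.+1 := Grassmannian (dU t).
pose u (i : 'I_r.+1) := if unlift ord0 i is Some j then (vbasis b)`_j else e.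
pose w (i : 'I_r.+1) : g := if unlift ord0 i is Some j then 0 else f.
have UE t : gr_space (U t) = <<[seq (u i + t *: w i)%R | i <- enum 'I_r.+1]>>%VS.
  rewrite enum_ordSl /= span_cons /u /w unlift_none addvC; congr (_ + _)%VS.
  rewrite -[LHS](span_basis (vbasisP b)); congr span.
  rewrite -map_comp -[LHS](mkseq_nth 0) size_tuple /mkseq -val_enum_ord -map_comp.
  by apply: eq_map => i /=; rewrite liftK scaler0 addr0.
have ZU t : 0 < t -> closure (Cartan g r.+1) (U t).
  move=> t0; apply: subset_closure; rewrite /Cartan /=.
  have [aU dgU] := sl2_conjugate ca ha ba erefl he hf bef t0.
  have [V cV UV] := cartan_above aU dgU.
  suff -> : (b + <[e + t *: f]>)%VS = V by [].
  by apply/eqP; rewrite eqEdim UV (rk _ cV) (eqP (dU t)) leqnn.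
have := zariski_closed_line clZ UE ZU (- 1).
apply: (@negative_not_in_closure _ _ _ _ _ (e - f)).
- by move=> W [_ dW _] y yW; apply/kappa_diag_ge0/(ad_diagonalizableW dW).
- by rewrite /= -scaleN1r (subvP (addvSr b _)) ?memv_line.
exact: (kappa_sl2 ss ca ha).
Qed.
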